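(* Let $\Bbbk$ be a field, $H$ a Hopf algebra over $\Bbbk$, $R$ a Hopf algebra in ${}^H_H\mathcal{YD}$ and $\mathcal{H}=R\#H$. Then $$\mathrm{C}'(\mathcal{H})=\{[(\mathcal{E}\#H,\gamma\otimes\mathrm{id})]\mid[(\mathcal{E},\gamma)]\in\mathrm{C}(R)\}=\{[(\Bbbk\#_{\Phi(\pi)}\mathcal{H},\mathrm{id}_{\mathcal{H}})]\mid\pi\in Z(R)\},$$ where for $\pi\in Z(R)$ the two-cocycle $\Phi(\pi):\mathcal{H}\otimes\mathcal{H}\to\Bbbk$ is given by $\Phi(\pi)(r\otimes h,r'\otimes h')=\pi(r,h\cdot r')\,\varepsilon_H(h')$ for $r,r'\in R$, $h,h'\in H$.
   Context: Conventions. ${}^H_H\mathcal{YD}$ is the category of left-left Yetter-Drinfeld modules over $H$, with coaction written $x\mapsto x_{(-1)}\otimes x_{(0)}$ and braiding $x\otimes y\mapsto x_{(-1)}\cdot y\otimes x_{(0)}$; the formula also makes sense for $x$ in a Yetter-Drinfeld module and $y$ in a left $H$-module. $\mathcal{H}=R\#H$ is the (ordinary) Hopf algebra on $R\otimes H$ with $(r\otimes h)(r'\otimes h')=r(h_{(1)}\cdot r')\otimes h_{(2)}h'$ and $\Delta(r\otimes h)=(r_{(1)}\otimes r_{(2)(-1)}h_{(1)})\otimes(r_{(2)(0)}\otimes h_{(2)})$. Objects over $R$. $R\otimes R$ is a coalgebra with $\Delta(r\otimes s)=(r_{(1)}\otimes r_{(2)(-1)}\cdot s_{(1)})\otimes(r_{(2)(0)}\otimes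 s_{(2)})$ and counit $\varepsilon_R\otimes\varepsilon_R$. $Z(R)$ is the set of $H$-module morphisms $\pi:R\otimes R\to\Bbbk$ that are convolution invertible for this coalgebra structure (with inverse an $H$-module morphism) and satisfy $\pi(1,1)=1$ and $\pi(r_{(1)},r_{(2)(-1)}\cdot s_{(1)})\,\pi(r_{(2)(0)}s_{(2)},t)=\pi(s_{(1)},s_{(2)(-1)}\cdot t_{(1)})\,\pi(r,s_{(2)(0)}t_{(2)})$ for all $r,s,t\in R$. An $R$-cleft object in $H$-mod is a left $H$-module algebra $\mathcal{E}$ with an $H$-linear right $R$-comodule structure $\rho_{\mathcal{E}}:\mathcal{E}\to\mathcal{E}\otimes R$, $e\mapsto e_{(0)}\otimes e_{(1)}$, that is an algebra morphism for the product $(e\otimes r)(e'\otimes r')=e(r_{(-1)}\cdot e')\otimes r_{(0)}r'$ on $\mathcal{E}\otimes R$, such that $\{e\in\mathcal{E}:\rho_{\mathcal{E}}(e)=e\otimes1\}=\Bbbk1$ and such that there is a section, i.e. an $H$-linear right $R$-comodule morphism $\gamma:R\to\mathcal{E}$ that is convolution invertible with $H$-linear inverse. Sections are normalized: $\gamma(1)=1$. $\mathrm{C}(R)$ is the set of isomorphism classes $[(\mathcal{E},\gamma)]$ of pairs of an $R$-cleft object in $H$-mod and a section; an isomorphism $(\mathcal{E},\gamma)\to(\mathcal{E}',\gamma')$ is an $H$-linear, $R$-colinear algebra isomorphism $f$ with $f\gamma=\gamma'$. Objects over $\mathcal{H}$. A classical two-cocycle is a convolution invertible linear map $\sigma:\mathcal{H}\otimes\mathcal{H}\to\Bbbk$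 with $\sigma(1,1)=1$ and $\sigma(x_{(1)},y_{(1)})\sigma(x_{(2)}y_{(2)},z)=\sigma(y_{(1)},z_{(1)})\sigma(x,y_{(2)}z_{(2)})$; for such $\sigma$, $\Bbbk\#_\sigma\mathcal{H}$ is $\mathcal{H}$ as right $\mathcal{H}$-comodule, with multiplication $x\cdot_\sigma y=\sigma(x_{(1)},y_{(1)})x_{(2)}y_{(2)}$. An $\mathcal{H}$-cleft object is a right $\mathcal{H}$-comodule algebra $E$ over $\Bbbk$ with coinvariants $\Bbbk1$ admitting a section, i.e. a convolution invertible $\mathcal{H}$-comodule map $\gamma:\mathcal{H}\to E$, again normalized by $\gamma(1)=1$. $\mathrm{C}(\mathcal{H})$ is the set of isomorphism classes $[(E,\gamma)]$ of pairs of an $\mathcal{H}$-cleft object and a section (isomorphisms: comodule algebra isomorphisms compatible with the sections). $\mathrm{C}'(\mathcal{H})$ is the set of $[(E,\gamma)]\in\mathrm{C}(\mathcal{H})$ with $\gamma((1\otimes h)(r\otimes h')(1\otimes h''))=\gamma(1\otimes h)\gamma(r\otimes h')\gamma(1\otimes h'')$ for all $r\in R$, $h,h',h''\in H$ (independent of the representative). $\mathcal{E}\#H$ is the smash product algebra on $\mathcal{E}\otimes H$, $(e\otimes h)(e'\otimes h')=e(h_{(1)}\cdot e')\otimes h_{(2)}h'$, with $\mathcal{H}$-coaction $e\otimes h\mapsto(e_{(0)}\otimes e_{(1)(-1)}h_{(1)})\otimes(e_{(1)(0)}\otimes h_{(2)})$. *)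

(* Defs.v *)
(* Hopf algebras, Yetter-Drinfeld Hopf algebras and cleft objects over a field,
   on top of MathComp. All maps out of a tensor product are written in
   Sweedler style by summing over pure tensors, see [tlift].                  *)
From HB Require Import structures.
From mathcomp Require Import all_boot all_algebra.
From mathcomp Require Import boolp.
From mathcomp Require Import generic_quotient.
Set Implicit Arguments.
Unset Strict Implicit.
Unset Printing Implicit Defensive.

Import GRing.Theory.
Local Open Scope ring_scope.
Local Open Scope quotient_scope.

Local Notation bilin f := (bilinear_for *:%R *:%R f).

(* V (x) W is the space of finite formal sums of pairs modulo the congruence
   generated by bilinearity; formal sums are sequences of pairs, scalars being
   carried by the first component.                                            *)
Section TensorRelation.
Variables (K : fieldType) (V W : lmodType K).

Inductive tensor_rel : seq (V * W) -> seq (V * W) -> Prop :=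
| tensor_refl s : tensor_rel s s
| tensor_sym s t : tensor_rel s t -> tensor_rel t s
| tensor_trans s t u : tensor_rel s t -> tensor_rel t u -> tensor_rel s u
| tensor_cat s s' t t' :
    tensor_rel s s' -> tensor_rel t t' -> tensor_rel (s ++ t) (s' ++ t')
| tensor_comm s t : tensor_rel (s ++ t) (t ++ s)
| tensor_zero y : tensor_rel [:: (0, y)] [::]
| tensor_addl x x' y : tensor_rel [:: (x + x', y)] [:: (x, y); (x', y)]
| tensor_addr x y y' : tensor_rel [:: (x, y + y')] [:: (x, y); (x, y')]
| tensor_scale a x y : tensor_rel [:: (a *: x, y)] [:: (x, a *: y)].

Definition tensor_relb (s t : seq (V * W)) : bool := `[< tensor_rel s t >].

Lemma tensor_relb_refl : reflexive tensor_relb.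
Proof. by move=> s; apply/asboolP; exact: tensor_refl. Qed.

Lemma tensor_relb_sym : symmetric tensor_relb.
Proof. by move=> s t; apply/asboolP/asboolP; exact: tensor_sym. Qed.

Lemma tensor_relb_trans : transitive tensor_relb.
Proof.
by move=> s t u /asboolP st /asboolP su; apply/asboolP; exact: tensor_trans st su.
Qed.

Canonical tensor_equiv :=
  EquivRel tensor_relb tensor_relb_refl tensor_relb_sym tensor_relb_trans.

Definition tensor : Type := {eq_quot tensor_equiv}.
HB.instance Definition _ := Choice.on tensor.
HB.instance Definition _ := Quotient.on tensor.

Lemma tensorW (P : tensor -> Prop) : (forall s, P (\pi_tensor s)) -> forall t, P t.
Proof. by move=> Ps t; rewrite -[t]reprK. Qed.

Lemma tensor_eqP s t : reflect (tensor_rel s t) (\pi_tensor s == \pi_tensor t).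
Proof. by rewrite eqmodE; exact: asboolP. Qed.

Lemma tensor_eq s t : tensor_rel s t -> \pi_tensor s = \pi_tensor t.
Proof. by move=> st; apply/eqP/tensor_eqP. Qed.

Lemma tensor_repr s : tensor_rel (repr (\pi_tensor s)) s.
Proof. by apply/tensor_eqP; rewrite reprK. Qed.

Definition tscale_seq (a : K) (s : seq (V * W)) := [seq (a *: p.1, p.2) | p <- s].

Lemma tscale_seq_rel a s t :
  tensor_rel s t -> tensor_rel (tscale_seq a s) (tscale_seq a t).
Proof.
elim=> {s t} [s|s t _ IH|s t u _ IH1 _ IH2|s s' t t' _ IH1 _ IH2|s t|y|x x' y|x y y'
  |b x y].
- exact: tensor_refl.
- exact: tensor_sym.
- exact: tensor_trans IH1 IH2.
- by rewrite /tscale_seq !map_cat; exact: tensor_cat.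
- by rewrite /tscale_seq !map_cat; exact: tensor_comm.
- by rewrite /= scaler0; exact: tensor_zero.
- by rewrite /= scalerDr; exact: tensor_addl.
- by rewrite /=; exact: tensor_addr.
- by rewrite /= scalerA mulrC -scalerA; exact: tensor_scale.
Qed.

Definition tadd (s t : tensor) : tensor := \pi_tensor (repr s ++ repr t).
Definition tscale (a : K) (s : tensor) : tensor :=
  \pi_tensor (tscale_seq a (repr s)).
Definition tzero : tensor := \pi_tensor [::].
Definition topp (s : tensor) : tensor := tscale (- 1) s.

Lemma pi_tadd s t : tadd (\pi_tensor s) (\pi_tensor t) = \pi_tensor (s ++ t).
Proof. by apply: tensor_eq; apply: tensor_cat; exact: tensor_repr. Qed.

Lemma pi_tscale a s : tscale a (\pi_tensor s) = \pi_tensor (tscale_seq a s).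
Proof. by apply: tensor_eq; apply: tscale_seq_rel; exact: tensor_repr. Qed.

Lemma taddA : associative tadd.
Proof.
move=> s t u; elim/tensorW: s => s; elim/tensorW: t => t; elim/tensorW: u => u.
by rewrite !pi_tadd catA.
Qed.

Lemma taddC : commutative tadd.
Proof.
move=> s t; elim/tensorW: s => s; elim/tensorW: t => t; rewrite !pi_tadd.
by apply: tensor_eq; exact: tensor_comm.
Qed.

Lemma tadd0 : left_id tzero tadd.
Proof. by move=> s; elim/tensorW: s => s; rewrite /tzero pi_tadd. Qed.

Lemma tscaleDl_seq a b s :
  tensor_rel (tscale_seq (a + b) s) (tscale_seq a s ++ tscale_seq b s).
Proof.
elim: s => [|[x y] s IH]; first exact: tensor_refl.
rewrite /= -(cat1s _ (tscale_seq _ s)) -(cat1s (b *: x, y)).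
apply: tensor_trans (tensor_cat _ IH) _.
  by rewrite scalerDl; exact: tensor_addl.
rewrite -(cat1s (a *: x, y) (tscale_seq a s ++ _)) -(cat1s (a *: x, y) [:: _]) -!catA.
apply: tensor_cat; first exact: tensor_refl.
rewrite !catA; apply: tensor_cat; [exact: tensor_comm | exact: tensor_refl].
Qed.

Lemma tscale0_seq s : tensor_rel (tscale_seq 0 s) [::].
Proof.
elim: s => [|[x y] s IH]; first exact: tensor_refl.
rewrite /= scale0r -cat1s -[X in tensor_rel _ X]cats0.
by apply: tensor_cat IH; exact: tensor_zero.
Qed.

Lemma tscale1 : left_id 1 tscale.
Proof.
move=> s; elim/tensorW: s => s; rewrite pi_tscale; congr (\pi_tensor _).
by elim: s => //= -[x y] s IH /=; rewrite scale1r IH.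
Qed.

Lemma tscaleA a b s : tscale a (tscale b s) = tscale (a * b) s.
Proof.
elim/tensorW: s => s; rewrite !pi_tscale /tscale_seq -map_comp.
by congr (\pi_tensor _); apply: eq_map => p /=; rewrite scalerA.
Qed.

Lemma tscaleDr : right_distributive tscale tadd.
Proof.
move=> a s t; elim/tensorW: s => s; elim/tensorW: t => t.
by rewrite !(pi_tadd, pi_tscale) /tscale_seq map_cat.
Qed.

Lemma tscaleDl s : {morph tscale^~ s : a b / a + b >-> tadd a b}.
Proof.
move=> a b; elim/tensorW: s => s; rewrite !pi_tscale pi_tadd.
by apply: tensor_eq; exact: tscaleDl_seq.
Qed.

Lemma taddN : left_inverse tzero topp tadd.
Proof.
move=> s; rewrite /topp -{2}[s]tscale1 -tscaleDl addNr.
by elim/tensorW: s => s; rewrite pi_tscale; apply: tensor_eq; exact: tscale0_seq.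
Qed.

HB.instance Definition _ := GRing.isZmodule.Build tensor taddA taddC tadd0 taddN.
HB.instance Definition _ := GRing.Zmodule_isLmodule.Build K tensor
  tscaleA tscale1 tscaleDr tscaleDl.

Definition tpure (x : V) (y : W) : tensor := \pi_tensor [:: (x, y)].

End TensorRelation.

Notation "x \ox y" := (tpure x y) (at level 40, left associativity) : ring_scope.

(* [tlift f t] evaluates f on a formal sum representing t. It is meaningful
   for bilinear f, where it is the linear map induced by f ([tlift_pure],
   [tlift_linear]); being total in f it needs no proof of bilinearity.        *)
Definition tlift (K : fieldType) (V W : lmodType K) (U : nmodType)
  (f : V -> W -> U) (t : tensor V W) : U := \sum_(p <- repr t) f p.1 p.2.

Notation "\tsum_ ( x \ox y <- t ) F" := (tlift (fun x y => F) t)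
  (at level 41, x name, y name, t at level 40, F at level 41,
   format "\tsum_ ( x  \ox  y  <-  t )  F") : ring_scope.

Section TensorTheory.
Variables (K : fieldType) (V W : lmodType K).

Lemma tpure_bilinear : bilin (@tpure K V W).
Proof.
split=> [y a x x'|x a y y'].
- transitivity (tadd (tscale a (x \ox y)) (x' \ox y)) => //.
  by rewrite pi_tscale pi_tadd; apply: tensor_eq; exact: tensor_addl.
- transitivity (tadd (tscale a (x \ox y)) (x \ox y')) => //.
  rewrite pi_tscale pi_tadd; apply: tensor_eq.
  apply: tensor_trans (tensor_addr _ _ _) _.
  apply: (@tensor_cat _ _ _ [:: _] [:: _] [:: _] [:: _]); last exact: tensor_refl.
  by apply: tensor_sym; exact: tensor_scale.
Qed.

Lemma tensor_sum (t : tensor V W) : t = \sum_(p <- repr t) p.1 \ox p.2.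
Proof.
rewrite -[LHS]reprK; elim: (repr t) => [|[x y] s IH]; first by rewrite big_nil.
rewrite big_cons -IH; transitivity (tadd (x \ox y) (\pi_(tensor V W) s)) => //.
by rewrite pi_tadd.
Qed.

Variables (U : lmodType K) (f : V -> W -> U).
Hypothesis f_bilinear : bilin f.

Lemma tensor_rel_sum s t : tensor_rel s t ->
  \sum_(p <- s) f p.1 p.2 = \sum_(p <- t) f p.1 p.2.
Proof.
case: f_bilinear => fl fr.
have fD x x' y : f (x + x') y = f x y + f x' y.
  by have /= := fl y 1 x x'; rewrite !scale1r.
have fD' x y y' : f x (y + y') = f x y + f x y'.
  by have /= := fr x 1 y y'; rewrite !scale1r.
have f0 y : f 0 y = 0 by apply: (addrI (f 0 y)); rewrite -fD !addr0.
have f0' x : f x 0 = 0 by apply: (addrI (f x 0)); rewrite -fD' !addr0.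
have fZ a x y : f (a *: x) y = a *: f x y.
  by have /= := fl y a x 0; rewrite f0 !addr0.
have fZ' a x y : f x (a *: y) = a *: f x y.
  by have /= := fr x a y 0; rewrite f0' !addr0.
elim=> {s t} [//|s t _ IH|s t u _ IH1 _ IH2|s s' t t' _ IH1 _ IH2|s t|y|x x' y
  |x y y'|b x y].
- by rewrite IH.
- by rewrite IH1.
- by rewrite !big_cat /= IH1 IH2.
- by rewrite !big_cat /= addrC.
- by rewrite big_seq1 big_nil f0.
- by rewrite big_seq1 big_cons big_seq1 fD.
- by rewrite big_seq1 big_cons big_seq1 fD'.
- by rewrite !big_seq1 fZ fZ'.
Qed.

Lemma tlift_pure x y : tlift f (x \ox y) = f x y.
Proof. by rewrite /tlift (tensor_rel_sum (tensor_repr _)) big_seq1. Qed.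

Lemma tlift_linear : linear (tlift f).
Proof.
case: f_bilinear => fl fr a s t.
have -> : a *: s + t = \pi_(tensor V W) (tscale_seq a (repr s) ++ repr t).
  by rewrite -pi_tadd reprK.
rewrite /tlift (tensor_rel_sum (tensor_repr _)) big_cat /= big_map scaler_sumr.
congr (_ + _); apply: eq_bigr => p _ /=.
have f0 : f 0 p.2 = 0.
  by have /= := fl p.2 1 0 0; rewrite !scale1r addr0 => /eqP;
     rewrite -subr_eq0 opprD addNKr oppr_eq0 => /eqP.
by have /= := fl p.2 a p.1 0; rewrite f0 !addr0.
Qed.

End TensorTheory.

Section Convolution.
Variables (K : fieldType) (C A : lmodType K).
Variables (Delta : C -> tensor C C) (eps : C -> K).
Variables (mul : A -> A -> A) (one : A).

Definition convolution (f g : C -> A) (x : C) : A :=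
  \tsum_(x1 \ox x2 <- Delta x) mul (f x1) (g x2).

Definition convolution_inverse (f g : C -> A) : Prop :=
  forall x, convolution f g x = eps x *: one /\ convolution g f x = eps x *: one.

End Convolution.

Section Comodules.
Variables (K : fieldType) (C V : lmodType K).
Variables (Delta : C -> tensor C C) (eps : C -> K).

Definition right_comodule (rho : V -> tensor V C) : Prop :=
  [/\ linear rho,
      forall v, \tsum_(v0 \ox v1 <- rho v) \tsum_(a \ox b <- rho v0) a \ox (b \ox v1)
              = \tsum_(v0 \ox v1 <- rho v) \tsum_(a \ox b <- Delta v1) v0 \ox (a \ox b)
    & forall v, \tsum_(v0 \ox v1 <- rho v) eps v1 *: v0 = v].

Definition left_comodule (delta : V -> tensor C V) : Prop :=
  [/\ linear delta,
      forall v, \tsum_(c \ox v0 <- delta v) \tsum_(a \ox b <- delta v0) c \ox (a \ox b)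
              = \tsum_(c \ox v0 <- delta v) \tsum_(a \ox b <- Delta c) a \ox (b \ox v0)
    & forall v, \tsum_(c \ox v0 <- delta v) eps c *: v0 = v].

Definition coalgebra : Prop :=
  [/\ linear Delta, scalar eps,
      forall x, \tsum_(x1 \ox x2 <- Delta x) \tsum_(a \ox b <- Delta x1) a \ox (b \ox x2)
              = \tsum_(x1 \ox x2 <- Delta x) \tsum_(a \ox b <- Delta x2) x1 \ox (a \ox b),
      forall x, \tsum_(x1 \ox x2 <- Delta x) eps x1 *: x2 = x
    & forall x, \tsum_(x1 \ox x2 <- Delta x) eps x2 *: x1 = x].

End Comodules.

Record hopfAlgebra (K : fieldType) := HopfAlgebra {
  hopf_alg :> algType K;
  hcomul : hopf_alg -> tensor hopf_alg hopf_alg;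
  hcounit : hopf_alg -> K;
  hantipode : hopf_alg -> hopf_alg;
  hopf_coalgebra : coalgebra hcomul hcounit;
  hcomulM : forall x y, hcomul (x * y) =
    \tsum_(x1 \ox x2 <- hcomul x) \tsum_(y1 \ox y2 <- hcomul y)
      (x1 * y1) \ox (x2 * y2);
  hcomul1 : hcomul 1 = 1 \ox 1;
  hcounitM : forall x y, hcounit (x * y) = hcounit x * hcounit y;
  hcounit1 : hcounit 1 = 1;
  hantipode_linear : linear hantipode;
  hantipodeP :
    convolution_inverse hcomul hcounit *%R (1 : hopf_alg) id hantipode }.

Section YetterDrinfeld.
Variables (K : fieldType) (H : hopfAlgebra K).

Definition hmodule (V : lmodType K) (act : H -> V -> V) : Prop :=
  [/\ bilin act,
      forall v, act 1 v = v
    & forall h h' v, act (h * h') v = act h (act h' v)].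

Definition hmodule_algebra (A : algType K) (act : H -> A -> A) : Prop :=
  [/\ hmodule act,
      forall h, act h 1 = hcounit h *: 1
    & forall h a b, act h (a * b) =
        \tsum_(h1 \ox h2 <- hcomul h) act h1 a * act h2 b].

Definition yd_module (V : lmodType K) (act : H -> V -> V)
    (delta : V -> tensor H V) : Prop :=
  [/\ hmodule act, left_comodule (@hcomul K H) (@hcounit K H) delta
    & forall h v, delta (act h v) =
        \tsum_(h1 \ox h' <- hcomul h) \tsum_(h2 \ox h3 <- hcomul h')
        \tsum_(c \ox w <- delta v) (h1 * c * hantipode h3) \ox act h2 w].

End YetterDrinfeld.

(* A Hopf algebra in the braided category of left-left Yetter-Drinfeld modules:
   all structure maps are H-linear and H-colinear, and [yd_comulM] says that the
   comultiplication is multiplicative for the braided product on R (x) R.      *)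
Record ydHopfAlgebra (K : fieldType) (H : hopfAlgebra K) := YDHopfAlgebra {
  yd_alg :> algType K;
  yd_act : H -> yd_alg -> yd_alg;
  yd_coact : yd_alg -> tensor H yd_alg;
  yd_comul : yd_alg -> tensor yd_alg yd_alg;
  yd_counit : yd_alg -> K;
  yd_antipode : yd_alg -> yd_alg;
  yd_yd_module : yd_module yd_act yd_coact;
  yd_module_algebra : hmodule_algebra yd_act;
  yd_coact1 : yd_coact 1 = 1 \ox 1;
  yd_coactM : forall r s, yd_coact (r * s) =
    \tsum_(c \ox r0 <- yd_coact r) \tsum_(d \ox s0 <- yd_coact s)
      (c * d) \ox (r0 * s0);
  yd_coalgebra : coalgebra yd_comul yd_counit;
  yd_comul_act : forall h r, yd_comul (yd_act h r) =
    \tsum_(h1 \ox h2 <- hcomul h) \tsum_(r1 \ox r2 <- yd_comul r)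
      yd_act h1 r1 \ox yd_act h2 r2;
  yd_counit_act : forall h r, yd_counit (yd_act h r) = hcounit h * yd_counit r;
  yd_coact_comul : forall r,
    \tsum_(c \ox r0 <- yd_coact r) c \ox yd_comul r0 =
    \tsum_(r1 \ox r2 <- yd_comul r)
    \tsum_(c \ox s <- yd_coact r1) \tsum_(d \ox t <- yd_coact r2)
      (c * d) \ox (s \ox t);
  yd_coact_counit : forall r,
    \tsum_(c \ox r0 <- yd_coact r) yd_counit r0 *: c = yd_counit r *: 1;
  yd_comul1 : yd_comul 1 = 1 \ox 1;
  yd_comulM : forall r s, yd_comul (r * s) =
    \tsum_(r1 \ox r2 <- yd_comul r) \tsum_(s1 \ox s2 <- yd_comul s)
    \tsum_(c \ox r0 <- yd_coact r2)
      (r1 * yd_act c s1) \ox (r0 * s2);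
  yd_counit1 : yd_counit 1 = 1;
  yd_counitM : forall r s, yd_counit (r * s) = yd_counit r * yd_counit s;
  yd_antipode_linear : linear yd_antipode;
  yd_antipode_act : forall h r, yd_antipode (yd_act h r) = yd_act h (yd_antipode r);
  yd_antipode_coact : forall r, yd_coact (yd_antipode r) =
    \tsum_(c \ox r0 <- yd_coact r) c \ox yd_antipode r0;
  yd_antipodeP :
    convolution_inverse yd_comul yd_counit *%R (1 : yd_alg) id yd_antipode }.

Section OverR.
Variables (K : fieldType) (H : hopfAlgebra K) (R : ydHopfAlgebra H).

Definition comulRR (z : tensor R R) : tensor (tensor R R) (tensor R R) :=
  \tsum_(r \ox s <- z)
  \tsum_(r1 \ox r2 <- yd_comul r) \tsum_(s1 \ox s2 <- yd_comul s)
  \tsum_(c \ox r0 <- yd_coact r2)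
    (r1 \ox yd_act c s1) \ox (r0 \ox s2).

Definition counitRR (z : tensor R R) : K :=
  \tsum_(r \ox s <- z) yd_counit r * yd_counit s.

Definition hlinear_form (p : tensor R R -> K) : Prop :=
  scalar p /\
  forall h r s, \tsum_(h1 \ox h2 <- hcomul h) p (yd_act h1 r \ox yd_act h2 s)
              = hcounit h * p (r \ox s).

Definition Z_R (p : tensor R R -> K) : Prop :=
  [/\ hlinear_form p,
      exists2 q, hlinear_form q
        & convolution_inverse comulRR counitRR *%R (1 : K^o) p q,
      p (1 \ox 1) = 1
    & forall r s t,
        \tsum_(r1 \ox r2 <- yd_comul r) \tsum_(s1 \ox s2 <- yd_comul s)
        \tsum_(c \ox r0 <- yd_coact r2)
          p (r1 \ox yd_act c s1) * p ((r0 * s2) \ox t)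
      = \tsum_(s1 \ox s2 <- yd_comul s) \tsum_(t1 \ox t2 <- yd_comul t)
        \tsum_(c \ox s0 <- yd_coact s2)
          p (s1 \ox yd_act c t1) * p (r \ox (s0 * t2))].

Section Cleft.
Variables (E : algType K) (act : H -> E -> E) (rho : E -> tensor E R).

Definition Rsection (g : R -> E) : Prop :=
  [/\ linear g /\ forall h r, g (yd_act h r) = act h (g r),
      forall r, rho (g r) = \tsum_(r1 \ox r2 <- yd_comul r) g r1 \ox r2,
      exists g' : R -> E,
        [/\ linear g', forall h r, g' (yd_act h r) = act h (g' r)
          & convolution_inverse (@yd_comul K H R) (@yd_counit K H R)
              *%R (1 : E) g g']
    & g 1 = 1].

Definition Rcleft : Prop :=
  [/\ [/\ hmodule_algebra act,
          right_comodule (@yd_comul K H R) (@yd_counit K H R) rho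
        & forall h e, rho (act h e) =
            \tsum_(h1 \ox h2 <- hcomul h) \tsum_(e0 \ox e1 <- rho e)
              act h1 e0 \ox yd_act h2 e1],
      rho 1 = 1 \ox 1,
      forall e e', rho (e * e') =
        \tsum_(e0 \ox e1 <- rho e) \tsum_(f0 \ox f1 <- rho e')
        \tsum_(c \ox r0 <- yd_coact e1) (e0 * act c f0) \ox (r0 * f1),
      forall e, rho e = e \ox 1 <-> exists a : K, e = a%:A
    & exists g, Rsection g].

End Cleft.

Record RcleftPair := MkRcleftPair {
  rc_alg :> algType K;
  rc_act : H -> rc_alg -> rc_alg;
  rc_coact : rc_alg -> tensor rc_alg R;
  rc_section : R -> rc_alg;
  rc_cleft : Rcleft rc_act rc_coact;
  rc_sectionP : Rsection rc_act rc_coact rc_section }.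

Definition Riso (X Y : RcleftPair) : Prop := exists f : X -> Y,
  [/\ [/\ linear f, bijective f, f 1 = 1 & {morph f : x y / x * y}],
      forall h x, f (rc_act h x) = rc_act h (f x),
      forall x, rc_coact (f x) = \tsum_(x0 \ox x1 <- rc_coact x) f x0 \ox x1
    & forall r, f (rc_section X r) = rc_section Y r].

Definition Rclass (X : RcleftPair) : RcleftPair -> Prop := Riso X.

(* Isomorphism classes are predicates on pairs, and sets of classes are
   predicates on classes: the sets of mathcomp-classical live in too small a
   universe to contain structures on arbitrary vector spaces.                 *)
Definition C_R (c : RcleftPair -> Prop) : Prop := exists X, c = Rclass X.

End OverR.

(* The objects over R # H are spaces with explicit structure maps, so that the
   several algebra structures carried by one tensor product can be compared;
   [cleft_pair] below singles out those satisfying the axioms.                *)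
Record bialgebraData (K : fieldType) := BialgebraData {
  bi_space :> lmodType K;
  bi_mul : bi_space -> bi_space -> bi_space;
  bi_one : bi_space;
  bi_comul : bi_space -> tensor bi_space bi_space;
  bi_counit : bi_space -> K }.

Record comodAlgPair (K : fieldType) (B : bialgebraData K) := ComodAlgPair {
  ca_space :> lmodType K;
  ca_mul : ca_space -> ca_space -> ca_space;
  ca_one : ca_space;
  ca_coact : ca_space -> tensor ca_space B;
  ca_section : B -> ca_space }.

Section OverB.
Variables (K : fieldType) (B : bialgebraData K).

Definition algebra (A : lmodType K) (mul : A -> A -> A) (one : A) : Prop :=
  [/\ bilin mul, associative mul, left_id one mul, right_id one mul
    & one != 0].

Definition Bsection (E : comodAlgPair B) (g : B -> E) : Prop :=
  [/\ linear g,
      forall x, ca_coact (g x) = \tsum_(x1 \ox x2 <- bi_comul x) g x1 \ox x2,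
      exists2 g' : B -> E, linear g'
        & convolution_inverse (@bi_comul K B) (@bi_counit K B)
            (@ca_mul K B E) (@ca_one K B E) g g'
    & g (bi_one B) = ca_one E].

Definition Bcleft (E : comodAlgPair B) : Prop :=
  [/\ algebra (@ca_mul K B E) (@ca_one K B E)
      /\ right_comodule (@bi_comul K B) (@bi_counit K B) (@ca_coact K B E),
      ca_coact (ca_one E) = ca_one E \ox bi_one B,
      forall e f : E, ca_coact (ca_mul e f) =
        \tsum_(e0 \ox e1 <- ca_coact e) \tsum_(f0 \ox f1 <- ca_coact f)
          ca_mul e0 f0 \ox bi_mul e1 f1,
      forall e : E, ca_coact e = e \ox bi_one B <-> exists a : K, e = a *: ca_one E
    & exists g, @Bsection E g].

Definition cleft_pair (X : comodAlgPair B) : Prop :=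
  Bcleft X /\ Bsection (@ca_section K B X).

Definition Biso (X Y : comodAlgPair B) : Prop := exists f : X -> Y,
  [/\ linear f /\ bijective f,
      f (ca_one X) = ca_one Y,
      forall x y, f (ca_mul x y) = ca_mul (f x) (f y),
      forall x, ca_coact (f x) = \tsum_(x0 \ox x1 <- ca_coact x) f x0 \ox x1
    & forall b, f (ca_section X b) = ca_section Y b].

Definition Bclass (X : comodAlgPair B) : comodAlgPair B -> Prop := Biso X.

Definition C_B (c : comodAlgPair B -> Prop) : Prop :=
  exists2 X, cleft_pair X & c = Bclass X.

Definition comulBB (z : tensor B B) : tensor (tensor B B) (tensor B B) :=
  \tsum_(x \ox y <- z)
  \tsum_(x1 \ox x2 <- bi_comul x) \tsum_(y1 \ox y2 <- bi_comul y)
    (x1 \ox y1) \ox (x2 \ox y2).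

Definition counitBB (z : tensor B B) : K :=
  \tsum_(x \ox y <- z) bi_counit x * bi_counit y.

Definition two_cocycle (sigma : tensor B B -> K) : Prop :=
  [/\ scalar sigma,
      exists2 tau : tensor B B -> K, scalar tau
        & convolution_inverse comulBB counitBB *%R (1 : K^o) sigma tau,
      sigma (bi_one B \ox bi_one B) = 1
    & forall x y z : B,
        \tsum_(x1 \ox x2 <- bi_comul x) \tsum_(y1 \ox y2 <- bi_comul y)
          sigma (x1 \ox y1) * sigma (bi_mul x2 y2 \ox z)
      = \tsum_(y1 \ox y2 <- bi_comul y) \tsum_(z1 \ox z2 <- bi_comul z)
          sigma (y1 \ox z1) * sigma (x \ox bi_mul y2 z2)].

Definition twist_mul (sigma : tensor B B -> K) (x y : B) : B :=
  \tsum_(x1 \ox x2 <- bi_comul x) \tsum_(y1 \ox y2 <- bi_comul y)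
    sigma (x1 \ox y1) *: bi_mul x2 y2.

Definition twist_pair (sigma : tensor B B -> K) : comodAlgPair B :=
  ComodAlgPair (twist_mul sigma) (bi_one B) (@bi_comul K B) id.

End OverB.

Section Bosonization.
Variables (K : fieldType) (H : hopfAlgebra K).

Definition smash_mul (A : algType K) (act : H -> A -> A) (x y : tensor A H) :
    tensor A H :=
  \tsum_(a \ox h <- x) \tsum_(b \ox k <- y)
  \tsum_(h1 \ox h2 <- hcomul h) (a * act h1 b) \ox (h2 * k).

Variable R : ydHopfAlgebra H.

Definition boson_comul (x : tensor R H) : tensor (tensor R H) (tensor R H) :=
  \tsum_(r \ox h <- x) \tsum_(r1 \ox r2 <- yd_comul r)
  \tsum_(h1 \ox h2 <- hcomul h) \tsum_(c \ox r0 <- yd_coact r2)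
    (r1 \ox (c * h1)) \ox (r0 \ox h2).

Definition boson_counit (x : tensor R H) : K :=
  \tsum_(r \ox h <- x) yd_counit r * hcounit h.

Definition boson : bialgebraData K :=
  BialgebraData (smash_mul (@yd_act K H R)) (1 \ox 1) boson_comul boson_counit.

Definition smash_coact (E : RcleftPair R) (x : tensor E H) :
    tensor (tensor E H) boson :=
  \tsum_(e \ox h <- x) \tsum_(e0 \ox e1 <- rc_coact e)
  \tsum_(h1 \ox h2 <- hcomul h) \tsum_(c \ox r <- yd_coact e1)
    (e0 \ox (c * h1)) \ox (r \ox h2 : boson).

Definition smash_section (E : RcleftPair R) (x : boson) : tensor E H :=
  \tsum_(r \ox h <- x) rc_section E r \ox h.

Definition smash_pair (E : RcleftPair R) : comodAlgPair boson :=
  ComodAlgPair (smash_mul (@rc_act K H R E)) (1 \ox 1)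
    (@smash_coact E) (@smash_section E).

Definition hbilinear_section (X : comodAlgPair boson) : Prop :=
  forall (r : R) (h h' h'' : H),
    ca_section X (bi_mul (bi_mul (1 \ox h : boson) (r \ox h')) (1 \ox h''))
    = ca_mul (ca_mul (ca_section X (1 \ox h)) (ca_section X (r \ox h')))
        (ca_section X (1 \ox h'')).

Definition C'_boson (c : comodAlgPair boson -> Prop) : Prop :=
  C_B c /\ exists2 X, c X & hbilinear_section X.

Definition Phi (p : tensor R R -> K) (z : tensor boson boson) : K :=
  \tsum_(x \ox y <- z) \tsum_(r \ox h <- x) \tsum_(r' \ox h' <- y)
    p (r \ox yd_act h r') * hcounit h'.

End Bosonization.

(* Main.v *)
(** A section of a cleft object over a Hopf algebra B is bijective, so the object
    is B with a twisted product x * y, and sigma(x, y) = eps(x * y) is the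
    corresponding two-cocycle. For B = R # H, a section compatible with left and
    right multiplication by H makes sigma balanced over H, so that sigma is
    determined by its restriction pi to R (x) R and equals Phi(pi); conversely
    Phi(pi) is always a two-cocycle. Restricting the twisted product of Phi(pi)
    to R gives an R-cleft object R_pi whose smash product with H is the twist of
    R # H by Phi(pi). All convolution inverses over R are obtained from inverses
    over R # H, where no braiding is involved, by uniqueness of inverses. *)
Require Import Defs.
From HB Require Import structures.
From mathcomp Require Import all_boot all_algebra.
From mathcomp Require Import boolp.
Set Implicit Arguments.
Unset Strict Implicit.
Unset Printing Implicit Defensive.
Import GRing.Theory.
Local Open Scope ring_scope.

(** * Linear maps and sums over tensors *)

(** Both equalities come from a cycle of inclusions: a class in C'(R # H) is a twist by some
    Phi(pi), such a twist is a smash product, and smash products lie in C'. Hence no R-cleft object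
    is extracted from an arbitrary cleft object; it is built on the space R itself. The obstacle is
    two-sided invertibility. Comultiplying r # 1 puts an H-component on the first leg only, so one
    of the two inverse laws over R can be read off directly and the other cannot. The accessible law
    yields a one-sided inverse over R # H, uniqueness identifies it with the given two-sided one,
    and the missing law is then brought back to R. Sweedler identities are settled by normalising
    both sides; antipode cancellations and the antipode-free Yetter-Drinfeld condition are inserted
    by hand. *)

Definition lin (K : fieldType) (V U : lmodType K) (f : V -> U) : Prop :=
  forall a x y, f (a *: x + y) = a *: f x + f y.

Definition blin (K : fieldType) (V W U : lmodType K) (F : V -> W -> U) : Prop :=
  (forall y, lin (F^~ y)) /\ (forall x, lin (F x)).

Definition tlin (K : fieldType) (V W X U : lmodType K)
    (F : V -> W -> X -> U) : Prop :=
  [/\ forall y z, lin (fun x => F x y z), forall x z, lin (fun y => F x y z)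
    & forall x y, lin (fun z => F x y z)].

Section Linear.
Variables (K : fieldType).
Implicit Types V W U X Y : lmodType K.

Lemma blinP V W U (F : V -> W -> U) :
  blin F <-> bilinear_for *:%R *:%R F.
Proof.
by split=> -[Fl Fr]; split.
Qed.

Lemma lin0 V U (f : V -> U) : lin f -> f 0 = 0.
Proof.
move=> lf; have := lf (-1) 0 0; rewrite scaler0 addr0 => ->.
by rewrite scaleN1r addNr.
Qed.

Lemma linZ V U (f : V -> U) a x : lin f -> f (a *: x) = a *: f x.
Proof. by move=> lf; rewrite -[a *: x]addr0 lf (lin0 lf) addr0. Qed.

Lemma linZK V (f : V -> K) a x : @lin K V K^o f -> f (a *: x) = a * f x.
Proof. exact: linZ. Qed.

Lemma linD V U (f : V -> U) x y : lin f -> f (x + y) = f x + f y.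
Proof. by move=> lf; rewrite -[x]scale1r lf !scale1r. Qed.

Lemma lin_id V : lin (fun x : V => x). Proof. by []. Qed.

Lemma lin_comp V W U (g : W -> U) (f : V -> W) :
  lin g -> lin f -> lin (fun x => g (f x)).
Proof. by move=> lg lf a x y; rewrite lf lg. Qed.

Lemma lin_sum V U I (r : seq I) (F : V -> I -> U) :
  (forall i, lin (F^~ i)) -> lin (fun x => \sum_(i <- r) F x i).
Proof.
move=> lF a x y; rewrite scaler_sumr -big_split; apply: eq_bigr => i _.
exact: lF.
Qed.

(** A variable can occur in two positions: in the summand, where linearity passes through a finite
    sum over a fixed representative, and in the tensor, [lin_tlift], where bilinearity makes the sum
    independent of the representative. *)
Lemma lin_tlift_body V W X U (F : V -> W -> X -> U) t :
  (forall x y, lin (fun v => F v x y)) -> lin (fun v => tlift (F v) t).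
Proof. by move=> lF; apply: lin_sum => -[x y]; apply: lF. Qed.

Lemma lin_tlift V W U (F : V -> W -> U) : blin F -> lin (tlift F).
Proof. by move=> /blinP bF a x y; rewrite (tlift_linear bF). Qed.

Lemma lin_mull (A : algType K) (b : A) : lin (fun x => x * b).
Proof. by move=> a x y; rewrite mulrDl scalerAl. Qed.

Lemma lin_mulr (A : algType K) (b : A) : lin ( *%R b).
Proof. by move=> a x y; rewrite mulrDr scalerAr. Qed.

Lemma lin_mulKl (b : K) : @lin K K^o K^o (fun x => x * b).
Proof. exact: (@lin_mull K^o). Qed.

Lemma lin_mulKr (b : K) : @lin K K^o K^o ( *%R b).
Proof. exact: (@lin_mulr K^o). Qed.

Lemma lin_scaler V (b : K) : @lin K V V ( *:%R b).
Proof. by move=> a x y; rewrite scalerDr !scalerA mulrC. Qed.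

Lemma lin_scalel V (v : V) : @lin K K^o V (fun x : K => x *: v).
Proof. by move=> a x y; rewrite scalerDl scalerA. Qed.

Lemma lin_tpurel V W (w : W) : @lin K V (tensor V W) (fun v => v \ox w).
Proof. by case: (tpure_bilinear V W) => + _; apply. Qed.

Lemma lin_tpurer V W (v : V) : @lin K W (tensor V W) (tpure v).
Proof. by case: (tpure_bilinear V W) => _; apply. Qed.

End Linear.

Section TensorSums.
Variable K : fieldType.
Implicit Types V W X Y U : lmodType K.

Lemma eq_tlift V W (U : nmodType) (F G : V -> W -> U) t :
  (forall x y, F x y = G x y) -> tlift F t = tlift G t.
Proof. by move=> FG; apply: eq_bigr => p _; apply: FG. Qed.

Lemma tlift_exch V W X Y (U : nmodType) (F : V -> W -> X -> Y -> U) s t :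
  tlift (fun u v => tlift (fun a b => F u v a b) t) s =
  tlift (fun a b => tlift (fun u v => F u v a b) s) t.
Proof. exact: exchange_big. Qed.

Lemma tlift_pureE U V W (F : V -> W -> U) x y : blin F -> tlift F (x \ox y) = F x y.
Proof. by move=> /blinP bF; apply: tlift_pure. Qed.

Lemma tlift_lin U X V W (g : X -> U) (F : V -> W -> X) t :
  lin g -> g (tlift F t) = tlift (fun x y => g (F x y)) t.
Proof.
move=> lg; apply: (big_morph g); last exact: lin0.
by move=> x y; apply: linD.
Qed.

Lemma tlift_tlift U V W X Y (F : V -> W -> U) (G : X -> Y -> tensor V W) t :
  blin F -> tlift F (tlift G t) = tlift (fun x y => tlift F (G x y)) t.
Proof. by move=> bF; apply: tlift_lin; apply: lin_tlift. Qed.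

Lemma tlift_scale U V W (F : V -> W -> U) a t :
  blin F -> tlift F (a *: t) = a *: tlift F t.
Proof. by move=> bF; apply: linZ; apply: lin_tlift. Qed.

Lemma tlift_tpure V W (t : tensor V W) : tlift (fun x y => x \ox y) t = t.
Proof. by rewrite [RHS]tensor_sum. Qed.

End TensorSums.

(** * Coalgebra and comodule axioms as rules under a multilinear summand *)

Section Cps.
Variable K : fieldType.
Implicit Types C V U : lmodType K.

(** Continuation-passing form: the axiom equates triple tensors, and applying to it the linear map
    induced by [F] equates sums with an arbitrary trilinear summand. Normalisation rewrites with
    this form; the comodule versions follow the same pattern. *)
Lemma coassocE U C (Delta : C -> tensor C C) (eps : C -> K)
    (coalg : coalgebra Delta eps) (F : C -> C -> C -> U) x : tlin F ->
  tlift (fun x1 x2 => tlift (fun a b => F a b x2) (Delta x1)) (Delta x) =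
  tlift (fun x1 x2 => tlift (fun a b => F x1 a b) (Delta x2)) (Delta x).
Proof.
case: coalg => _ _ /(_ x) co _ _ [F1 F2 F3].
have := congr1 (tlift (fun a z => tlift (fun b c => F a b c) z)) co.
have bF a : blin (F a) by split=> // y; apply: F2.
have bF' : blin (fun a z => tlift (fun b c => F a b c) z).
  split=> [z|a]; last exact: lin_tlift.
  by apply: lin_sum => -[b c]; apply: F1.
rewrite !tlift_tlift //.
under eq_tlift => x1 x2.
  rewrite tlift_tlift //; under eq_tlift do rewrite tlift_pureE // tlift_pureE //.
  over.
move->; apply: eq_tlift => x1 x2.
by rewrite tlift_tlift //; apply: eq_tlift => a b; rewrite !tlift_pureE.
Qed.

(** The counit enters as a scalar argument of [G], so that the rule applies wherever the factor
    [eps x1] stands in the summand. *)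
Lemma counit_lE U C (Delta : C -> tensor C C) (eps : C -> K)
    (coalg : coalgebra Delta eps) (G : K^o -> C -> U) x : blin G ->
  tlift (fun x1 x2 => G (eps x1) x2) (Delta x) = G (1 : K) x.
Proof.
case: coalg => _ _ _ /(_ x) co _ [G1 G2].
rewrite -{2}co (tlift_lin _ _ (G2 1)); apply: eq_tlift => x1 x2.
rewrite (linZ _ _ (G2 1)) -(linZ (V := K^o) _ _ (G1 x2)).
by congr (G _ x2); rewrite /GRing.scale /= mulr1.
Qed.

Lemma counit_rE U C (Delta : C -> tensor C C) (eps : C -> K)
    (coalg : coalgebra Delta eps) (G : K^o -> C -> U) x : blin G ->
  tlift (fun x1 x2 => G (eps x2) x1) (Delta x) = G (1 : K) x.
Proof.
case: coalg => _ _ _ _ /(_ x) co [G1 G2].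
rewrite -{2}co (tlift_lin _ _ (G2 1)); apply: eq_tlift => x1 x2.
rewrite (linZ _ _ (G2 1)) -(linZ (V := K^o) _ _ (G1 x1)).
by congr (G _ x1); rewrite /GRing.scale /= mulr1.
Qed.

Lemma rcoassocE U C V (Delta : C -> tensor C C) (eps : C -> K)
    (rho : V -> tensor V C) (com : right_comodule Delta eps rho)
    (F : V -> C -> C -> U) v : tlin F ->
  tlift (fun v0 v1 => tlift (fun a b => F a b v1) (rho v0)) (rho v) =
  tlift (fun v0 v1 => tlift (fun a b => F v0 a b) (Delta v1)) (rho v).
Proof.
case: com => _ /(_ v) co _ [F1 F2 F3].
have := congr1 (tlift (fun a z => tlift (fun b c => F a b c) z)) co.
have bF a : blin (F a) by split=> // y; apply: F2.
have bF' : blin (fun a z => tlift (fun b c => F a b c) z).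
  split=> [z|a]; last exact: lin_tlift.
  by apply: lin_sum => -[b c]; apply: F1.
rewrite !tlift_tlift //.
under eq_tlift => x1 x2.
  rewrite tlift_tlift //; under eq_tlift do rewrite tlift_pureE // tlift_pureE //.
  over.
move->; apply: eq_tlift => x1 x2.
by rewrite tlift_tlift //; apply: eq_tlift => a b; rewrite !tlift_pureE.
Qed.

Lemma rcounitE U C V (Delta : C -> tensor C C) (eps : C -> K)
    (rho : V -> tensor V C) (com : right_comodule Delta eps rho)
    (G : K^o -> V -> U) v : blin G ->
  tlift (fun v0 v1 => G (eps v1) v0) (rho v) = G (1 : K) v.
Proof.
case: com => _ _ /(_ v) co [G1 G2].
rewrite -{2}co (tlift_lin _ _ (G2 1)); apply: eq_tlift => x1 x2.
rewrite (linZ _ _ (G2 1)) -(linZ (V := K^o) _ _ (G1 x1)).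
by congr (G _ x1); rewrite /GRing.scale /= mulr1.
Qed.

Lemma lcoassocE U C V (Delta : C -> tensor C C) (eps : C -> K)
    (delta : V -> tensor C V) (com : left_comodule Delta eps delta)
    (F : C -> C -> V -> U) v : tlin F ->
  tlift (fun c v0 => tlift (fun a b => F a b v0) (Delta c)) (delta v) =
  tlift (fun c v0 => tlift (fun a b => F c a b) (delta v0)) (delta v).
Proof.
case: com => _ /(_ v) co _ [F1 F2 F3].
have := congr1 (tlift (fun a z => tlift (fun b c => F a b c) z)) co.
have bF a : blin (F a) by split=> // y; apply: F2.
have bF' : blin (fun a z => tlift (fun b c => F a b c) z).
  split=> [z|a]; last exact: lin_tlift.
  by apply: lin_sum => -[b c]; apply: F1.
rewrite !tlift_tlift // => /esym.
under eq_tlift => x1 x2.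
  rewrite tlift_tlift //; under eq_tlift do rewrite tlift_pureE // tlift_pureE //.
  over.
move->; apply: eq_tlift => x1 x2.
by rewrite tlift_tlift //; apply: eq_tlift => a b; rewrite !tlift_pureE.
Qed.

Lemma lcounitE U C V (Delta : C -> tensor C C) (eps : C -> K)
    (delta : V -> tensor C V) (com : left_comodule Delta eps delta)
    (G : K^o -> V -> U) v : blin G ->
  tlift (fun c v0 => G (eps c) v0) (delta v) = G (1 : K) v.
Proof.
case: com => _ _ /(_ v) co [G1 G2].
rewrite -{2}co (tlift_lin _ _ (G2 1)); apply: eq_tlift => x1 x2.
rewrite (linZ _ _ (G2 1)) -(linZ (V := K^o) _ _ (G1 x2)).
by congr (G _ x2); rewrite /GRing.scale /= mulr1.
Qed.

End Cps.

Section HopfFacts.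
Variables (K : fieldType) (H : hopfAlgebra K).

Lemma hcomul_lin : lin (@hcomul K H).
Proof. by case: (hopf_coalgebra H). Qed.

Lemma hcounit_lin : @lin K H K^o (@hcounit K H).
Proof. by case: (hopf_coalgebra H). Qed.

Lemma hantipode_lin : lin (@hantipode K H).
Proof. exact: hantipode_linear. Qed.

(** Normalisation does not cancel antipodes, so each use of this rule follows a regrouping that
    exhibits [h1 * hantipode h2]. *)
Lemma hantipode_rE (U : lmodType K) (F : H -> U) h : lin F ->
  tlift (fun h1 h2 => F (h1 * hantipode h2)) (hcomul h) = hcounit h *: F 1.
Proof.
by move=> lF; case: (hantipodeP h) => + _; rewrite -(linZ _ _ lF) => <-; rewrite -tlift_lin.
Qed.

Lemma hantipode_lE (U : lmodType K) (F : H -> U) h : lin F ->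
  tlift (fun h1 h2 => F (hantipode h1 * h2)) (hcomul h) = hcounit h *: F 1.
Proof.
by move=> lF; case: (hantipodeP h) => _; rewrite -(linZ _ _ lF) => <-; rewrite -tlift_lin.
Qed.

Variable R : ydHopfAlgebra H.

Lemma yd_act_linr h : lin (@yd_act K H R h).
Proof. by case: (yd_module_algebra R) => -[[_ +] _ _] _ _; apply. Qed.

Lemma yd_act_linl r : lin (fun h => @yd_act K H R h r).
Proof. by case: (yd_module_algebra R) => -[[+ _] _ _] _ _; apply. Qed.

Lemma yd_left_comodule :
  left_comodule (@hcomul K H) (@hcounit K H) (@yd_coact K H R).
Proof. by case: (yd_yd_module R). Qed.

Lemma yd_coact_lin : lin (@yd_coact K H R).
Proof. by case: yd_left_comodule. Qed.

Lemma yd_comul_lin : lin (@yd_comul K H R).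
Proof. by case: (yd_coalgebra R). Qed.

Lemma yd_counit_lin : @lin K R K^o (@yd_counit K H R).
Proof. by case: (yd_coalgebra R). Qed.

Lemma yd_act1 r : @yd_act K H R 1 r = r.
Proof. by case: (yd_module_algebra R) => -[_ + _] _ _; apply. Qed.

Lemma yd_actA h k r : @yd_act K H R (h * k) r = yd_act h (yd_act k r).
Proof. by case: (yd_module_algebra R) => -[_ _ +] _ _; apply. Qed.

Lemma yd_act_1 h : @yd_act K H R h 1 = hcounit h *: 1.
Proof. by case: (yd_module_algebra R) => _ + _; apply. Qed.

Lemma yd_act_mul h (r s : R) : yd_act h (r * s) =
  tlift (fun h1 h2 => yd_act h1 r * yd_act h2 s) (hcomul h).
Proof. by case: (yd_module_algebra R) => _ _; apply. Qed.

Lemma yd_coact_act h r : @yd_coact K H R (yd_act h r) =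
  \tsum_(h1 \ox h' <- hcomul h) \tsum_(h2 \ox h3 <- hcomul h')
  \tsum_(c \ox w <- yd_coact r) (h1 * c * hantipode h3) \ox yd_act h2 w.
Proof. by case: (yd_yd_module R) => _ _; apply. Qed.

End HopfFacts.

Section YdCps.
Variables (K : fieldType) (H : hopfAlgebra K) (R : ydHopfAlgebra H).

Lemma yd_coact_comulE (U : lmodType K) (F : H -> R -> R -> U) r : tlin F ->
  tlift (fun c r0 => tlift (fun a b => F c a b) (yd_comul r0)) (yd_coact r) =
  tlift (fun r1 r2 => tlift (fun c s => tlift (fun d t => F (c * d) s t)
    (yd_coact r2)) (yd_coact r1)) (yd_comul r).
Proof.
move=> [F1 F2 F3].
have := congr1 (tlift (fun a z => tlift (fun b c => F a b c) z)) (yd_coact_comul r).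
have bF a : blin (F a) by split=> // y; apply: F2.
have bF' : blin (fun a z => tlift (fun b c => F a b c) z).
  split=> [z|a]; last exact: lin_tlift.
  by apply: lin_sum => -[b c]; apply: F1.
rewrite !tlift_tlift //.
under eq_tlift do rewrite tlift_pureE //.
move->; apply: eq_tlift => x1 x2; rewrite tlift_tlift //; apply: eq_tlift => a b.
by rewrite tlift_tlift //; apply: eq_tlift => c d; rewrite !tlift_pureE.
Qed.

Lemma yd_coact_counitE (U : lmodType K) (G : K^o -> H -> U) (r : R) : blin G ->
  tlift (K := K) (fun c r0 => G (yd_counit r0) c) (yd_coact r) = G (yd_counit r) 1.
Proof.
move=> [G1 G2]; have co := yd_coact_counit r.
have -> : G (yd_counit r) 1 = G 1 (yd_counit r *: 1).
  rewrite (linZ _ _ (G2 1)) -(linZ (V := K^o) _ _ (G1 _)).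
  by congr (G _ _); rewrite /GRing.scale /= mulr1.
rewrite -co (tlift_lin _ _ (G2 1)); apply: eq_tlift => x1 x2.
rewrite (linZ _ _ (G2 1)) -(linZ (V := K^o) _ _ (G1 x1)).
by congr (G _ x1); rewrite /GRing.scale /= mulr1.
Qed.

End YdCps.

(** * Normalisation of Sweedler sums *)

Create HintDb lin.

Ltac lin_comp_with g u :=
  lazymatch goal with
  | |- @lin ?K ?V ?U _ =>
    first [ refine (@lin_comp K V _ U g u _ _)
          | refine (@lin_comp K V K^o U g u _ _) ]
  end.

Ltac lin_base :=
  first [ solve [auto 1 with lin nocore]
        | lazymatch goal with
          | |- lin (tpure _) => exact: lin_tpurer
          | |- lin (fun x => tpure x _) => exact: lin_tpurel
          | |- lin (fun x => @GRing.mul _ x ?b) =>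
            first [exact: lin_mulKl | exact: lin_mull]
          | |- lin (@GRing.mul _ ?a) =>
            first [exact: lin_mulKr | exact: lin_mulr]
          | |- lin (fun x => @GRing.mul _ ?a x) =>
            first [exact: lin_mulKr | exact: lin_mulr]
          | |- lin (fun x => @GRing.scale _ _ x ?b) => exact: lin_scalel
          | |- lin (@GRing.scale _ _ ?a) => exact: lin_scaler
          | |- lin (@hcomul _ _) => exact: hcomul_lin
          | |- lin (@hcounit _ _) => exact: hcounit_lin
          | |- lin (@hantipode _ _) => exact: hantipode_lin
          | |- lin (@yd_act _ _ _ _) => exact: yd_act_linr
          | |- lin (fun x => @yd_act _ _ _ x _) => exact: yd_act_linl
          | |- lin (@yd_coact _ _ _) => exact: yd_coact_lin
          | |- lin (@yd_comul _ _ _) => exact: yd_comul_lin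
          | |- lin (@yd_counit _ _ _) => exact: yd_counit_lin
          end ].

(* The [constr:(_)] tests reject subterms mentioning the bound variable. *)
Ltac lin :=
  cbv beta;
  match goal with
  | |- blin _ => split; intro; lin
  | |- tlin _ => split; intros ? ?; lin
  | |- lin (fun x => x) => exact (@lin_id _ _)
  | |- lin (fun x => tlift (@?F x) ?t) =>
      let _ := constr:(t) in apply: lin_tlift_body; intros ? ?; lin
  | |- lin (fun x => tlift ?F x) =>
      let _ := constr:(F) in apply: lin_tlift; lin
  | |- lin (fun x => tlift ?F (@?u x)) =>
      let _ := constr:(F) in
      lin_comp_with (tlift F) u; [apply: lin_tlift; lin | lin]
  | |- lin (tlift _) => apply: lin_tlift; lin
  | |- lin _ => lin_base
  | |- lin (fun x => ?g (@?u x)) =>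
      let _ := constr:(g) in lin_comp_with g u; [lin_base | lin]
  | |- lin (fun x => ?g (@?u x) ?b) =>
      let _ := constr:(g) in let _ := constr:(b) in
      lin_comp_with (fun z => g z b) u; [lin_base | lin]
  | |- lin (fun x => ?g (@?u x) ?b ?c) =>
      let _ := constr:(g) in let _ := constr:(b) in let _ := constr:(c) in
      lin_comp_with (fun z => g z b c) u; [lin_base | lin]
  end.

Create HintDb coalg.
Create HintDb sweedler.

(* In a K-valued sum the codomain is the field K, from which unification cannot
   guess the module K^o. *)
Ltac ap_scal L :=
  lazymatch goal with
  | |- @eq (GRing.Field.sort ?K) _ _ => apply: (L K (K^o : lmodType K))
  | |- @tlift ?K _ _ _ _ _ = _ =>
      first [apply: (L _ _) | apply: (L K (K^o : lmodType K))]
  end.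

(* Ltac evaluates an argument starting with a match before the call, hence the
   leading [idtac] in the uses of [step_then]. *)
Ltac step_then t := etransitivity; [ solve [t] | ].

Ltac under_tlift tac :=
  refine (eq_tlift _ _);
  let x := fresh "x" in let y := fresh "y" in intros x y; cbv beta; tac x y.

(* [bubble x] moves the sum over [D x] to the top of the left-hand side. *)
Ltac bubble x :=
  lazymatch goal with
  | |- tlift _ (_ x) = _ => reflexivity
  | |- tlift _ _ = _ =>
      etransitivity; [under_tlift ltac:(fun _ _ => bubble x) | refine (tlift_exch _ _ _)]
  end.

Ltac coalg :=
  first [ solve [eauto 2 with coalg nocore]
        | exact: hopf_coalgebra | exact: yd_coalgebra | exact: yd_left_comodule ].

(** Applies when the first leg of the outer sum is expanded again further inside: the inner sum is
    pulled up next to it and rebracketed to the right. *)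
Ltac redex_first :=
  etransitivity;
  [ under_tlift ltac:(fun x y => bubble x)
  | first [ ap_scal @coassocE; [coalg | lin]
          | ap_scal @rcoassocE; [coalg | lin]
          | ap_scal @lcoassocE; [coalg | lin] ] ].

Ltac redex_second :=
  etransitivity;
  [ under_tlift ltac:(fun x y => bubble y)
  | ap_scal @yd_coact_comulE; lin ].

Ltac eps_of x b :=
  lazymatch b with
  | context [@hcounit ?K ?H x] => constr:(@hcounit K H x)
  | context [@yd_counit ?K ?H ?R x] => constr:(@yd_counit K H R x)
  | context [@bi_counit ?K ?B x] => constr:(@bi_counit K B x)
  end.

(* The summand [b] with its factor [eps x] replaced by [k]. *)
Ltac abs_eps x b k :=
  let e := eps_of x b in
  let p := eval pattern e in b in
  lazymatch p with ?f _ => let r := eval cbv beta in (f k) in exact r end.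

Ltac cu_scal L g :=
  lazymatch goal with
  | |- @tlift ?K _ _ _ _ _ = _ =>
    first [ eapply L with (G := g) | eapply (L (K^o : lmodType K)) with (G := g) ]
  end; [coalg | lin].

Ltac counit_first :=
  lazymatch goal with
  | |- @tlift ?K ?V ?W ?U ?F ?t = _ =>
    let x := fresh "x" in let y := fresh "y" in let k := fresh "k" in
    let g := constr:(fun (k : K^o) (y : W) (x : V) =>
      ltac:(let b := eval cbv beta in (F x y) in abs_eps x b k)) in
    (* Once [eps x] is abstracted, [x] should no longer occur, and 0 is a dummy for it. If it does
       occur, [G] fails to match the summand and the tactic fails. *)
    let g := eval cbv beta in (fun (k : K^o) (y : W) => g k y 0) in
    first [ cu_scal (@counit_lE K) g
          | cu_scal (@lcounitE K) g ]
  end.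

Ltac counit_second :=
  lazymatch goal with
  | |- @tlift ?K ?V ?W ?U ?F ?t = _ =>
    let x := fresh "x" in let y := fresh "y" in let k := fresh "k" in
    let g := constr:(fun (k : K^o) (x : V) (y : W) =>
      ltac:(let b := eval cbv beta in (F x y) in abs_eps y b k)) in
    let g := eval cbv beta in (fun (k : K^o) (x : V) => g k x 0) in
    first [ cu_scal (@counit_rE K) g
          | cu_scal (@rcounitE K) g
          | first [ eapply (@yd_coact_counitE K) with (G := g)
                  | eapply (@yd_coact_counitE K _ _ K^o) with (G := g) ]; lin ]
  end.

(* [auto] also tries the hypotheses of the context. *)
Ltac expand_arg :=
  first [ exact: hcomulM | exact: hcomul1 | exact: yd_comulM | exact: yd_comul1
        | exact: yd_coactM | exact: yd_coact1 | exact: yd_comul_act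
        | exact: yd_coact_act | solve [auto 1 with sweedler nocore]].

#[export] Hint Rewrite hcounitM : leaf.
#[export] Hint Rewrite yd_act1 yd_actA yd_act_1 yd_act_mul : leafsum.

Ltac expand_var :=
  lazymatch goal with
  | |- _ ?x = _ => is_var x; symmetry; apply: tlift_tpure
  end.

Ltac leaf_simp :=
  rewrite ?(hcounitM, hcounit1, yd_counit_act, yd_counitM, yd_counit1);
  rewrite ?(scale1r, mul1r, mulr1, yd_act1);
  autorewrite with leaf.

Ltac pull_scale b s :=
  let p := eval pattern s in b in
  lazymatch p with
  | ?g _ =>
    etransitivity;
    [ solve [first [ apply: (linZ (f := g)) | apply: (linZK (f := g)) ]; lin] | ]
  end.

Ltac pull_tlift b s K V W F t :=
  let p := eval pattern s in b in
  lazymatch p with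
  | ?g _ =>
    etransitivity;
    [ solve [first [ apply: (@tlift_lin K _ _ V W g F t)
                   | apply: (@tlift_lin K _ K^o V W g F t)
                   | apply: (@tlift_lin K K^o _ V W g F t)
                   | apply: (@tlift_lin K K^o K^o V W g F t) ]; lin]
    | ]
  end.

(* Normal form of a Sweedler sum: the sums come first and range over
   comultiplications and coactions of variables, iterated ones being bracketed to
   the right and coactions following comultiplications; counits are eliminated and
   scalars are moved to the front of the summand. *)
Ltac nf :=
  cbv beta;
  lazymatch goal with
  | |- tlift _ (tpure _ _) = _ => step_then ltac:(idtac; ap_scal @tlift_pureE; lin); nf
  | |- tlift _ (tlift _ _) = _ => step_then ltac:(idtac; ap_scal @tlift_tlift; lin); nf
  | |- tlift _ (_ *: _) = _ => step_then ltac:(idtac; ap_scal @tlift_scale; lin); nf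
  | |- tlift ?F ?t = _ =>
      first [ lazymatch t with
              | context [@tlift ?K ?V ?W ?U ?F' ?t'] =>
                pull_tlift (tlift F t) (@tlift K V W U F' t') K V W F' t'; nf
              | context [@GRing.scale ?R ?V ?c ?w] =>
                pull_scale (tlift F t) (@GRing.scale R V c w); nf
              end
            | step_then ltac:(idtac; refine (congr1 (tlift F) _); expand_arg); nf
            | etransitivity; [under_tlift ltac:(fun _ _ => nf) | nf_post] ]
  | |- _ => nf_leaf
  end
with nf_post :=
  cbv beta;
  first [ step_then ltac:(idtac; redex_first); nf
        | step_then ltac:(idtac; redex_second); nf
        | step_then ltac:(idtac; counit_first); nf
        | step_then ltac:(idtac; counit_second); nf
        | reflexivity ]
with nf_leaf :=
  try (progress autorewrite with leafsum);
  lazymatch goal with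
  | |- ?b = _ =>
    lazymatch b with
    | context [@tlift ?K ?V ?W ?U ?F ?t] =>
      pull_tlift b (@tlift K V W U F t) K V W F t; nf
    | ?a *: (?b *: ?v) => step_then ltac:(idtac; exact: scalerA); nf
    | ?a *: ?v =>
      lazymatch v with
      | context [@GRing.scale ?R ?V ?c ?w] => pull_scale b (@GRing.scale R V c w); nf
      | tpure _ _ => leaf_simp; reflexivity
      | _ =>
        first [ step_then ltac:(idtac; refine (congr1 ( *:%R a) _);
                  first [expand_arg | expand_var]); nf
              | leaf_simp; reflexivity ]
      end
    | context [@GRing.scale ?R ?V ?c ?w] => pull_scale b (@GRing.scale R V c w); nf
    | tpure _ _ => leaf_simp; reflexivity
    | _ * _ => leaf_simp; reflexivity
    | _ => first [ step_then ltac:(idtac; expand_arg); nf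
                 | step_then ltac:(idtac; expand_var); nf | leaf_simp; reflexivity ]
    end
  end.

(** Convertible structure maps may differ syntactically, as [bi_comul] of [boson R] and
    [boson_comul] do, so equal arguments are accepted as a match. *)
Ltac bubble_to t :=
  lazymatch goal with
  | |- tlift _ ?s = _ =>
    first [ first [ constr_eq s t
                  | lazymatch s with ?D ?x =>
                      lazymatch t with ?D' ?x' => constr_eq x x' end end ];
            reflexivity
          | etransitivity;
            [under_tlift ltac:(fun _ _ => bubble_to t) | refine (tlift_exch _ _ _)] ]
  end.

(* Matches two normal forms up to the order of independent sums. *)
Ltac sums_match :=
  cbv beta;
  lazymatch goal with
  | |- tlift _ ?t = _ =>
      symmetry; etransitivity; [bubble_to t | ];
      symmetry; under_tlift ltac:(fun _ _ => sums_match)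
  | |- _ => try reflexivity
  end.

(** What is left to the caller is at most an equation between summands, typically an associativity
    or unit law. *)
Ltac sw :=
  etransitivity; [nf | ]; symmetry; etransitivity; [nf | ]; symmetry; sums_match.

(** * Cleft objects over a Hopf algebra *)

Definition ualg (K : fieldType) (A : lmodType K) (mul : A -> A -> A) (one : A) : Prop :=
  [/\ blin mul, associative mul, left_id one mul & right_id one mul].

Lemma convE (K : fieldType) (C A U : lmodType K) (Delta : C -> tensor C C)
    (eps : C -> K) (mul : A -> A -> A) (one : A) (f g : C -> A) (F : A -> U) x :
  (forall x, convolution Delta mul f g x = eps x *: one) -> lin F ->
  tlift (fun x1 x2 => F (mul (f x1) (g x2))) (Delta x) = eps x *: F one.
Proof. by move=> fg lF; rewrite -(linZ _ _ lF) -fg -tlift_lin. Qed.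

Section Convol.
Variables (K : fieldType) (C A : lmodType K).
Variables (Delta : C -> tensor C C) (eps : C -> K) (mul : A -> A -> A) (one : A).
Hypotheses (coalgC : coalgebra Delta eps) (algA : ualg mul one).

Lemma coalgebra_lin : lin Delta. Proof. by case: coalgC. Qed.
Lemma coalgebra_eps_lin : @lin K C K^o eps. Proof. by case: coalgC. Qed.
Lemma ualg_linl y : lin (mul^~ y). Proof. by case: algA => -[+ _] _ _ _; apply. Qed.
Lemma ualg_linr x : lin (mul x). Proof. by case: algA => -[_ +] _ _ _; apply. Qed.
Hint Resolve coalgebra_lin coalgebra_eps_lin ualg_linl ualg_linr : lin.
Hint Resolve coalgC : coalg.

(** g = g * (f * h) = (g * f) * h = h. Only one law is asked of each of [g] and [h], which is what
    allows a one-sided check to be upgraded later. *)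
Lemma convolution_inverse_uniq (f g h : C -> A) :
  lin f -> lin g -> lin h ->
  (forall x, convolution Delta mul g f x = eps x *: one) ->
  (forall x, convolution Delta mul f h x = eps x *: one) -> g =1 h.
Proof.
move=> lf lg lh gf fh x; case: algA => _ mA m1l m1r.
transitivity (tlift (fun x1 x2 => mul (g x1) (eps x2 *: one)) (Delta x)).
  under eq_tlift do rewrite (linZ _ _ (ualg_linr _)) m1r.
  rewrite (counit_rE coalgC (G := fun k y => k *: g y)) ?scale1r //; lin.
transitivity (tlift (fun x1 x2 => mul (eps x1 *: one) (h x2)) (Delta x)); last first.
  under eq_tlift do rewrite (linZ _ _ (ualg_linl _)) m1l.
  rewrite (counit_lE coalgC (G := fun k y => k *: h y)) ?scale1r //; lin.
under eq_tlift do rewrite -fh; under [RHS]eq_tlift do rewrite -gf.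
by rewrite /convolution; sw; rewrite mA.
Qed.

End Convol.

Lemma tensor_ext (K : fieldType) (V W U : lmodType K) (f g : tensor V W -> U) :
  lin f -> lin g -> (forall x y, f (x \ox y) = g (x \ox y)) -> f =1 g.
Proof.
move=> lf lg fg t; rewrite -[t]tlift_tpure !(tlift_lin _ _ lf) !(tlift_lin _ _ lg).
by apply: eq_tlift => x y; apply: fg.
Qed.

(** Stated for explicit structure maps because the theory is applied to [boson R], whose product is
    data and not a canonical ring structure. *)
Record hopf_axioms (K : fieldType) (B : bialgebraData K) (S : B -> B) : Prop := {
  ha_coalg : coalgebra (@bi_comul K B) (@bi_counit K B);
  ha_alg : ualg (@bi_mul K B) (@bi_one K B);
  ha_comulM : forall x y : B, bi_comul (bi_mul x y) =
    \tsum_(x1 \ox x2 <- bi_comul x) \tsum_(y1 \ox y2 <- bi_comul y)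
      bi_mul x1 y1 \ox bi_mul x2 y2;
  ha_comul1 : bi_comul (bi_one B) = bi_one B \ox bi_one B;
  ha_counitM : forall x y : B, bi_counit (bi_mul x y) = bi_counit x * bi_counit y;
  ha_counit1 : bi_counit (bi_one B) = 1;
  ha_S_lin : lin S;
  ha_S : convolution_inverse (@bi_comul K B) (@bi_counit K B) (@bi_mul K B) (bi_one B)
           id S }.

Section HopfB.
Variables (K : fieldType) (B : bialgebraData K) (S : B -> B).
Hypothesis hB : hopf_axioms S.

Local Notation one := (bi_one B).
Local Notation m := (@bi_mul K B).
Local Notation D := (@bi_comul K B).
Local Notation eps := (@bi_counit K B).

Let Dcoalg : coalgebra D eps. Proof. exact: ha_coalg hB. Qed.
Let D_lin : lin D. Proof. by case: Dcoalg. Qed.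
Let eps_lin : @lin K B K^o eps. Proof. by case: Dcoalg. Qed.
Let S_lin : lin S. Proof. exact: ha_S_lin hB. Qed.
Let m_linl y : lin (m^~ y). Proof. exact: ualg_linl (ha_alg hB) y. Qed.
Let m_linr x : lin (m x). Proof. exact: ualg_linr (ha_alg hB) x. Qed.
Let mA : associative m. Proof. by case: (ha_alg hB). Qed.
Let m1l : left_id one m. Proof. by case: (ha_alg hB). Qed.
Let m1r : right_id one m. Proof. by case: (ha_alg hB). Qed.
Let DM := ha_comulM hB.
Let D1 := ha_comul1 hB.
Let epsM := ha_counitM hB.
Let eps1 := ha_counit1 hB.

Hint Resolve D_lin eps_lin S_lin m_linl m_linr : lin.
Hint Resolve Dcoalg : coalg.
Hint Extern 0 (D _ = _) => exact: DM : sweedler.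
Hint Extern 0 (D _ = _) => exact: D1 : sweedler.

Lemma comulBBE x y : comulBB (x \ox y) =
  \tsum_(x1 \ox x2 <- D x) \tsum_(y1 \ox y2 <- D y) (x1 \ox y1) \ox (x2 \ox y2).
Proof. by rewrite /comulBB tlift_pureE //; lin. Qed.

Lemma counitBBE x y : counitBB (x \ox y) = eps x * eps y.
Proof. by rewrite /counitBB (@tlift_pureE _ K^o) //; lin. Qed.

Lemma comulBB_lin : lin (@comulBB K B). Proof. by rewrite /comulBB; lin. Qed.

Lemma counitBB_lin : @lin K _ K^o (@counitBB K B).
Proof. by apply: (@lin_tlift _ _ _ K^o); lin. Qed.
Hint Resolve comulBB_lin counitBB_lin : lin.
Hint Extern 0 (comulBB _ = _) => exact: comulBBE : sweedler.

Hint Rewrite epsM eps1 counitBBE : leaf.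

Lemma comulBB_coalgebra : coalgebra (@comulBB K B) (@counitBB K B).
Proof.
split; [exact: comulBB_lin | exact: counitBB_lin | | |].
- apply: tensor_ext; [lin | lin | move=> x y].
  by sw.
- by apply: tensor_ext; [lin | lin | move=> x y; etransitivity; [nf|]].
- by apply: tensor_ext; [lin | lin | move=> x y; etransitivity; [nf|]].
Qed.

Lemma eps_S x : eps (S x) = eps x.
Proof.
have := congr1 eps (ha_S hB x).1; rewrite (linZ _ _ eps_lin) eps1.
rewrite /GRing.scale /= mulr1 => <-.
rewrite /convolution (@tlift_lin K K^o B) //.
by symmetry; etransitivity; [nf|].
Qed.


Let S_r x : convolution D m id S x = eps x *: one. Proof. exact: (ha_S hB x).1. Qed.
Let S_l x : convolution D m S id x = eps x *: one. Proof. exact: (ha_S hB x).2. Qed.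

(** * From a cleft object over B to a two-cocycle *)

Section Comodule_algebra.
Variables (E : comodAlgPair B).
Local Notation mE := (@ca_mul K B E).
Local Notation oneE := (ca_one E).
Local Notation rho := (@ca_coact K B E).
Hypotheses (algE : ualg mE oneE) (comE : right_comodule D eps rho).
Hypothesis rho1 : rho oneE = oneE \ox one.
Hypothesis rhoM : forall e f : E, rho (mE e f) =
  \tsum_(e0 \ox e1 <- rho e) \tsum_(f0 \ox f1 <- rho f) mE e0 f0 \ox m e1 f1.
Variables g g' : B -> E.
Hypotheses (lg : lin g) (lg' : lin g').
Hypothesis rho_g : forall x, rho (g x) = \tsum_(x1 \ox x2 <- D x) g x1 \ox x2.
Hypothesis gg' : convolution_inverse D eps mE oneE g g'.

Let rho_lin : lin rho. Proof. by case: comE. Qed.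
Let mE_linl y : lin (mE^~ y). Proof. exact: ualg_linl algE y. Qed.
Let mE_linr x : lin (mE x). Proof. exact: ualg_linr algE x. Qed.
Let mEA : associative mE. Proof. by case: algE. Qed.
Let mE1l : left_id oneE mE. Proof. by case: algE. Qed.
Let mE1r : right_id oneE mE. Proof. by case: algE. Qed.
Let gg'_r x : convolution D mE g g' x = eps x *: oneE. Proof. exact: (gg' x).1. Qed.
Let gg'_l x : convolution D mE g' g x = eps x *: oneE. Proof. exact: (gg' x).2. Qed.

Hint Resolve lg lg' rho_lin mE_linl mE_linr : lin.
Hint Resolve comE : coalg.
Hint Extern 0 (rho _ = _) => exact: rho_g : sweedler.
Hint Extern 0 (rho _ = _) => exact: rhoM : sweedler.
Hint Extern 0 (rho _ = _) => exact: rho1 : sweedler.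

Definition tmul (s t : tensor E B) : tensor E B :=
  \tsum_(e \ox b <- s) \tsum_(f \ox c <- t) mE e f \ox m b c.

Lemma tmul_ualg : ualg tmul (oneE \ox one).
Proof.
have bl : blin tmul by rewrite /tmul; lin.
have lml y : lin (tmul^~ y) by case: bl.
have lmr y : lin (tmul y) by case: bl.
split=> //.
- move=> s t u; move: s; apply: tensor_ext; [lin | lin | move=> e b].
  move: t; apply: tensor_ext; [lin | lin | move=> f c].
  move: u; apply: tensor_ext; [lin | lin | move=> h d].
  by rewrite /tmul; sw; rewrite mEA mA.
- apply: tensor_ext; [lin | lin | move=> e b].
  by rewrite /tmul; sw; rewrite mE1l m1l.
- apply: tensor_ext; [lin | lin | move=> e b].
  by rewrite /tmul; sw; rewrite mE1r m1r.
Qed.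

(** Both sides are convolution inverse to [rho \o g] in the algebra of maps from B to E (x) B: the
    left one because [rho] is multiplicative, the right one by cancelling first S and then [g']. *)
Lemma rho_section_inverse x : rho (g' x) = \tsum_(x1 \ox x2 <- D x) g' x2 \ox S x1.
Proof.
apply: (convolution_inverse_uniq Dcoalg tmul_ualg (f := fun x => rho (g x))
  (g := fun x => rho (g' x))
  (h := fun x => \tsum_(x1 \ox x2 <- D x) g' x2 \ox S x1)); try lin; move=> {}x.
- have -> : eps x *: (oneE \ox one) = rho (eps x *: oneE) by rewrite (linZ _ _ rho_lin) rho1.
  rewrite -gg'_l /convolution (tlift_lin _ _ rho_lin).
  by apply: eq_tlift => x1 x2; rewrite rhoM.
- transitivity (\tsum_(x1 \ox y <- D x) \tsum_(z \ox x4 <- D y)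
    \tsum_(x2 \ox x3 <- D z) mE (g x1) (g' x4) \ox m x2 (S x3)).
    by rewrite /convolution /tmul; sw.
  transitivity (\tsum_(x1 \ox y <- D x) \tsum_(z \ox x4 <- D y)
    eps z *: (mE (g x1) (g' x4) \ox one)).
    apply: eq_tlift => x1 y; apply: eq_tlift => z x4.
    by apply: (convE (F := fun b => mE (g x1) (g' x4) \ox b) _ S_r); lin.
  transitivity (\tsum_(x1 \ox x2 <- D x) mE (g x1) (g' x2) \ox one); first by sw.
  by apply: (convE (F := fun e => e \ox one) _ gg'_r); lin.
Qed.

Hint Extern 0 (rho _ = _) => exact: rho_section_inverse : sweedler.

Hypothesis coinvE : forall e, rho e = e \ox one -> exists a : K, e = a *: oneE.

(** The standard projection of a cleft object onto its coinvariants. *)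
Definition coinvariant_part (e : E) : E := \tsum_(e0 \ox e1 <- rho e) mE e0 (g' e1).

(** By [rho_section_inverse] the coaction gives e_(0) g'(e_(3)) (x) e_(1) S(e_(2)), in which S
    cancels. *)
Lemma coinvariant_partP e : exists a : K, coinvariant_part e = a *: oneE.
Proof.
apply: coinvE; rewrite /coinvariant_part.
transitivity (\tsum_(e0 \ox y <- rho e) \tsum_(z \ox e3 <- D y)
    \tsum_(e1 \ox e2 <- D z) mE e0 (g' e3) \ox m e1 (S e2)); first by sw.
transitivity (\tsum_(e0 \ox y <- rho e) \tsum_(z \ox e3 <- D y)
    eps z *: (mE e0 (g' e3) \ox one)).
  apply: eq_tlift => x1 y; apply: eq_tlift => z x4.
  by apply: (convE (F := fun b => mE x1 (g' x4) \ox b) _ S_r); lin.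
by sw.
Qed.

Hypotheses (oneE_neq0 : oneE != 0) (g1 : g one = oneE).

Lemma coinvariant_part_lin : lin coinvariant_part.
Proof. by rewrite /coinvariant_part; lin. Qed.

(** The scalar is unique as the unit is nonzero. Along the section this form is the counit of B, see
    [coform_section]. *)
Definition coform (e : E) : K := projT1 (cid (coinvariant_partP e)).

Lemma coformP e : coinvariant_part e = coform e *: oneE.
Proof. by rewrite /coform; case: cid. Qed.

Lemma scale_oneE_inj a b : a *: oneE = b *: oneE -> a = b.
Proof.
move=> /eqP; rewrite -subr_eq0 -scalerBl scaler_eq0 (negPf oneE_neq0) orbF.
by rewrite subr_eq0 => /eqP.
Qed.

Lemma coform_lin : @lin K E K^o coform.
Proof.
move=> a e f; apply: scale_oneE_inj.
by rewrite -coformP coinvariant_part_lin !coformP scalerDl scalerA.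
Qed.
Hint Resolve coform_lin : lin.

Lemma coform_section x : coform (g x) = eps x.
Proof.
apply: scale_oneE_inj; rewrite -coformP -gg'_r /coinvariant_part /convolution.
by sw.
Qed.
Hint Rewrite coform_section : leaf.

(** Read off from e = e_(0) g'(e_(1)) g(e_(2)) = [coform](e_(0)) g(e_(1)). *)
Definition section_inv (e : E) : B := \tsum_(e0 \ox e1 <- rho e) coform e0 *: e1.

Lemma section_inv_lin : lin section_inv. Proof. by rewrite /section_inv; lin. Qed.
Hint Resolve section_inv_lin : lin.

Lemma section_invK : cancel section_inv g.
Proof.
move=> e; rewrite /section_inv (tlift_lin _ _ lg).
transitivity (\tsum_(e0 \ox e1 <- rho e) mE (coinvariant_part e0) (g e1)).
  apply: eq_tlift => e0 e1.
  by rewrite coformP (linZ _ _ (mE_linl _)) mE1l (linZ _ _ lg).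
rewrite /coinvariant_part.
transitivity (\tsum_(e0 \ox y <- rho e) \tsum_(e1 \ox e2 <- D y)
   mE e0 (mE (g' e1) (g e2))); first by sw; rewrite mEA.
transitivity (\tsum_(e0 \ox y <- rho e) eps y *: mE e0 oneE).
  by apply: eq_tlift => e0 y; apply: (convE _ gg'_l); lin.
by etransitivity; [nf | rewrite ?mE1r].
Qed.

Lemma sectionK : cancel g section_inv.
Proof. by move=> x; rewrite /section_inv; etransitivity; [nf|]. Qed.

Lemma section_inv_colinear e :
  D (section_inv e) = \tsum_(e0 \ox e1 <- rho e) section_inv e0 \ox e1.
Proof. by rewrite /section_inv; sw. Qed.
Hint Extern 0 (D _ = _) => exact: section_inv_colinear : sweedler.

Definition star (x y : B) : B := section_inv (mE (g x) (g y)).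

Lemma star_linl y : lin (star^~ y). Proof. by rewrite /star; lin. Qed.
Lemma star_linr x : lin (star x). Proof. by rewrite /star; lin. Qed.
Hint Resolve star_linl star_linr : lin.

Lemma starA : associative star.
Proof. by move=> x y z; rewrite /star !section_invK mEA. Qed.

Lemma starM x y : D (star x y) =
  \tsum_(x1 \ox x2 <- D x) \tsum_(y1 \ox y2 <- D y) star x1 y1 \ox m x2 y2.
Proof. by rewrite /star; sw. Qed.

Definition sigma (z : tensor B B) : K := tlift (fun x y => eps (star x y)) z.

Lemma sigma_lin : @lin K _ K^o sigma.
Proof. by apply: (@lin_tlift _ _ _ K^o); lin. Qed.
Hint Resolve sigma_lin : lin.

Lemma sigmaE x y : sigma (x \ox y) = eps (star x y).
Proof. by rewrite /sigma (@tlift_pureE _ K^o) //; lin. Qed.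

(** An element is recovered from its comultiplication by the counit, and [starM] gives the
    comultiplication of x * y as x_(1) * y_(1) (x) x_(2) y_(2). *)
Lemma twist_mul_sigma x y : twist_mul sigma x y = star x y.
Proof.
transitivity (\tsum_(a \ox b <- D (star x y)) eps a *: b); last first.
  by rewrite (counit_lE Dcoalg (G := fun k y => k *: y)) ?scale1r //; lin.
rewrite starM /twist_mul.
rewrite tlift_tlift; last lin.
apply: eq_tlift => x1 x2; rewrite tlift_tlift; last lin.
by apply: eq_tlift => y1 y2; rewrite tlift_pureE ?sigmaE //; lin.
Qed.

Lemma section_mul x y : mE (g x) (g y) =
  \tsum_(x1 \ox x2 <- D x) \tsum_(y1 \ox y2 <- D y) sigma (x1 \ox y1) *: g (m x2 y2).
Proof.
rewrite -[LHS]section_invK -/(star x y) -twist_mul_sigma /twist_mul.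
by rewrite (tlift_lin _ _ lg); apply: eq_tlift => x1 x2;
  rewrite (tlift_lin _ _ lg); apply: eq_tlift => y1 y2; rewrite (linZ _ _ lg).
Qed.

(* The convolution inverse of sigma has values in E; a linear form equal to 1 at
   the unit makes it scalar. *)
Definition tau (z : tensor B B) : K := tlift (fun x y =>
  \tsum_(x1 \ox x2 <- D x) \tsum_(y1 \ox y2 <- D y)
     coform (mE (g (m x1 y1)) (mE (g' y2) (g' x2)))) z.

Lemma tau_lin : @lin K _ K^o tau.
Proof. by apply: (@lin_tlift _ _ _ K^o); lin. Qed.
Hint Resolve tau_lin : lin.

Lemma tauE x y : tau (x \ox y) =
  coform (\tsum_(x1 \ox x2 <- D x) \tsum_(y1 \ox y2 <- D y)
    mE (g (m x1 y1)) (mE (g' y2) (g' x2))).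
Proof. by rewrite /tau (@tlift_pureE _ K^o) //; [sw | lin]. Qed.

(** The textbook formula for the cocycle of a section, obtained from [section_mul] by multiplying
    with [g'] on the right. *)
Lemma sigma_scalar x y : sigma (x \ox y) *: oneE =
  \tsum_(x1 \ox x2 <- D x) \tsum_(y1 \ox y2 <- D y)
    mE (mE (g x1) (g y1)) (g' (m x2 y2)).
Proof.
under eq_tlift do under eq_tlift do rewrite section_mul.
transitivity (\tsum_(x1 \ox x2 <- D x) \tsum_(y1 \ox y2 <- D y)
  sigma (x1 \ox y1) *: \tsum_(a \ox b <- D (m x2 y2)) mE (g a) (g' b)); last by sw.
transitivity (\tsum_(x1 \ox x2 <- D x) \tsum_(y1 \ox y2 <- D y)
  sigma (x1 \ox y1) *: (eps (m x2 y2) *: oneE)).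
  by symmetry; etransitivity; [nf|].
by apply: eq_tlift => x1 x2; apply: eq_tlift => y1 y2; rewrite -gg'_r.
Qed.

Lemma coform_one : coform oneE = 1.
Proof. by rewrite -g1 coform_section eps1. Qed.

Lemma sigma_tau : convolution_inverse (@comulBB K B) (@counitBB K B) *%R (1 : K^o) sigma tau.
Proof.
have coZ a : coform (a *: oneE) = a.
  by rewrite (linZK _ _ coform_lin) coform_one mulr1.
move=> z; split; move: z; rewrite /convolution;
  apply: (@tensor_ext _ _ _ K^o); [lin | lin | move=> x y | lin | lin | move=> x y].
- transitivity (\tsum_(x1 \ox x2 <- D x) \tsum_(y1 \ox y2 <- D y)
    sigma (x1 \ox y1) * tau (x2 \ox y2)); first by sw.
  under eq_tlift do under eq_tlift do rewrite tauE.
  transitivity (\tsum_(x1 \ox x2 <- D x) \tsum_(y1 \ox y2 <- D y)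
    coform (mE (\tsum_(a \ox b <- D x1) \tsum_(c \ox d <- D y1)
             sigma (a \ox c) *: g (m b d)) (mE (g' y2) (g' x2)))); first by sw.
  under eq_tlift do under eq_tlift do rewrite -section_mul.
  transitivity (\tsum_(x1 \ox x2 <- D x)
    coform (mE (g x1) (mE (convolution D mE g g' y) (g' x2)))).
    by rewrite /convolution; sw; rewrite !mEA.
  rewrite gg'_r counitBBE.
  transitivity (coform (eps y *: convolution D mE g g' x)).
    by rewrite /convolution; sw; rewrite mE1l.
  by rewrite gg'_r scalerA coZ mulrC /GRing.scale /= mulr1.
- transitivity (\tsum_(x1 \ox x2 <- D x) \tsum_(y1 \ox y2 <- D y)
    sigma (x2 \ox y2) * tau (x1 \ox y1)); first by sw; rewrite mulrC.
  (* The factor sigma has to enter under the same [coform] as tau: it is replaced by its E-valued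
     expression from [sigma_scalar]. *)
  transitivity (\tsum_(x1 \ox x2 <- D x) \tsum_(y1 \ox y2 <- D y)
    coform (mE (\tsum_(a \ox b <- D x1) \tsum_(c \ox d <- D y1)
                  mE (g (m a c)) (mE (g' d) (g' b)))
               (\tsum_(a \ox b <- D x2) \tsum_(c \ox d <- D y2)
                  mE (mE (g a) (g c)) (g' (m b d))))).
    apply: eq_tlift => x1 x2; apply: eq_tlift => y1 y2.
    by rewrite -sigma_scalar (linZ _ _ (mE_linr _)) mE1r tauE (linZK _ _ coform_lin).
  (* The inner word g'(y) g'(x) g(x) g(y) telescopes from the middle outwards. *)
  have collapse xa ya : \tsum_(y2 \ox y3 <- D ya)
      mE (mE (g' y2) (convolution D mE g' g xa)) (g y3) = (eps xa * eps ya) *: oneE.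
    rewrite -scalerA -(gg'_l ya) [in RHS]/convolution (tlift_lin _ _ (@lin_scaler _ _ _)).
    apply: eq_tlift => y1 y2.
    by rewrite gg'_l (linZ _ _ (mE_linr _)) mE1r (linZ _ _ (mE_linl _)).
  transitivity (\tsum_(x1 \ox x' <- D x) \tsum_(y1 \ox y' <- D y)
    \tsum_(xa \ox x4 <- D x') \tsum_(ya \ox y4 <- D y')
    coform (mE (mE (g (m x1 y1)) (\tsum_(y2 \ox y3 <- D ya)
      mE (mE (g' y2) (convolution D mE g' g xa)) (g y3))) (g' (m x4 y4)))).
    by rewrite /convolution; sw; rewrite !mEA.
  under eq_tlift do under eq_tlift do under eq_tlift do under eq_tlift do rewrite collapse.
  transitivity (coform (convolution D mE g g' (m x y))).
    by rewrite /convolution; sw; rewrite mE1r.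
  by rewrite gg'_r coZ counitBBE epsM /GRing.scale /= mulr1.
Qed.

(** The two sides of the cocycle identity are the counits of (x * y) * z and x * (y * z), so the
    identity is associativity of [star]. *)
Lemma sigma_cocycle : two_cocycle sigma.
Proof.
split; first exact: sigma_lin.
- by exists tau; [exact: tau_lin | exact: sigma_tau].
- by rewrite sigmaE /star g1 mE1l -g1 sectionK eps1.
- move=> x y z; transitivity (eps (star (star x y) z)).
    rewrite -sigmaE -(twist_mul_sigma x y) /twist_mul.
    by sw.
  rewrite -starA -sigmaE -(twist_mul_sigma y z) /twist_mul.
  by sw.
Qed.

End Comodule_algebra.

Theorem cleft_twist (X : comodAlgPair B) : cleft_pair X ->
  exists2 s : tensor B B -> K, two_cocycle s & Biso X (twist_pair s).
Proof.
case=> -[[[bX mXA mX1l mX1r neq0] comX] rho1 rhoM coinvX _].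
case=> lg rho_g [g' lg' gg'] g1.
have algX : ualg (@ca_mul K B X) (@ca_one K B X) by split=> //; apply/blinP.
have coinvX' e : ca_coact e = e \ox one -> exists a : K, e = a *: ca_one X.
  by move/(coinvX e).
pose s := sigma algX comX rho1 rhoM lg lg' rho_g gg' coinvX'.
exists s; first exact: sigma_cocycle.
exists (section_inv algX comX rho1 rhoM lg lg' rho_g gg' coinvX').
split.
- split; first exact: section_inv_lin.
  by exists (ca_section X); [exact: section_invK | exact: sectionK].
- by rewrite /= -g1 sectionK.
- by move=> x y; rewrite /= twist_mul_sigma // /star !section_invK.
- by move=> x; rewrite /= section_inv_colinear.
- by move=> b; rewrite /= sectionK.
Qed.

Lemma coalgebra_right_comodule : right_comodule D eps D.
Proof. by case: Dcoalg. Qed.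

(** B is a comodule algebra over itself with section [id], whose inverse is S; this is
    [rho_section_inverse] in that case. *)
Lemma comul_antipode x : D (S x) = \tsum_(x1 \ox x2 <- D x) S x2 \ox S x1.
Proof.
apply: (@rho_section_inverse (@ComodAlgPair K B B m one D id) (ha_alg hB)
  coalgebra_right_comodule D1 DM id S) => //.
by move=> y; rewrite tlift_tpure.
Qed.
Hint Extern 0 (D (S _) = _) => exact: comul_antipode : sweedler.
Hint Rewrite eps_S : leaf.

(** * From a two-cocycle on B to a cleft object *)

Section Twist.
Variable s : tensor B B -> K.
Hypothesis cs : two_cocycle s.

Local Notation tw := (twist_mul s).

Let s_lin : @lin K _ K^o s. Proof. by case: cs. Qed.
Hint Resolve s_lin : lin.

(** An invertible idempotent is the unit: u = (v * u) * u = v * (u * u) = v * u. *)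
Lemma convolution_idem (u v : B -> K) : @lin K _ K^o u -> @lin K _ K^o v ->
  (forall x, \tsum_(x1 \ox x2 <- D x) v x1 * u x2 = eps x) ->
  (forall x, u x = \tsum_(x1 \ox x2 <- D x) u x1 * u x2) -> u =1 eps.
Proof.
move=> lu lv vu uu x; rewrite -vu.
under [RHS]eq_tlift do rewrite uu.
transitivity (\tsum_(x1 \ox x2 <- D x) (\tsum_(a \ox b <- D x1) v a * u b) * u x2).
  by under eq_tlift do rewrite vu; symmetry; etransitivity; [nf|].
by sw; rewrite mulrA.
Qed.

(** The cocycle identity at (1, 1, x), with s(1, 1) = 1, makes s(1, -) a convolution idempotent, and
    it is invertible because s is. The identity at (x, 1, 1) does the same on the other side. *)
Lemma cocycle1l x : s (one \ox x) = eps x.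
Proof.
case: cs => _ [t lt0 st] s11 cocy; have lt : @lin K _ K^o t := lt0.
move: x; apply: (convolution_idem (v := fun x => t (one \ox x))); [lin | lin | |] => x.
  have := (st (one \ox x)).2; rewrite /convolution counitBBE eps1 mul1r.
  rewrite /GRing.scale /= mulr1 => <-.
  by sw.
have := cocy one one x.
have -> : \tsum_(x1 \ox x2 <- D one) \tsum_(y1 \ox y2 <- D one)
   s (x1 \ox y1) * s (m x2 y2 \ox x) = s (one \ox x).
  by etransitivity; [nf | rewrite s11 mul1r m1l].
by move->; etransitivity; [nf | under eq_tlift do rewrite m1l].
Qed.

Lemma cocycle1r x : s (x \ox one) = eps x.
Proof.
case: cs => _ [t lt0 st] s11 cocy; have lt : @lin K _ K^o t := lt0.
move: x; apply: (convolution_idem (v := fun x => t (x \ox one))); [lin | lin | |] => x.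
  have := (st (x \ox one)).2; rewrite /convolution counitBBE eps1 mulr1.
  rewrite /GRing.scale /= mulr1 => <-.
  by sw.
have := cocy x one one.
have -> : \tsum_(x1 \ox x2 <- D one) \tsum_(y1 \ox y2 <- D one)
   s (x1 \ox y1) * s (x \ox m x2 y2) = s (x \ox one).
  by etransitivity; [nf | rewrite s11 mul1r m1l].
by move<-; etransitivity; [nf | under eq_tlift do rewrite m1r].
Qed.

Lemma twist_linl y : lin (tw^~ y). Proof. by rewrite /twist_mul; lin. Qed.
Lemma twist_linr x : lin (tw x). Proof. by rewrite /twist_mul; lin. Qed.
Hint Resolve twist_linl twist_linr : lin.

Lemma comul_twist x y : D (tw x y) =
  \tsum_(x1 \ox x2 <- D x) \tsum_(y1 \ox y2 <- D y) tw x1 y1 \ox m x2 y2.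
Proof. by rewrite /twist_mul; sw. Qed.
Hint Extern 0 (D (tw _ _) = _) => exact: comul_twist : sweedler.

(** The cocycle identity with its inner sums collected into twisted products. Associativity of the
    twisted product and the invariance of s under H both rest on this form. *)
Lemma cocycle_twist x y z : s (tw x y \ox z) = s (x \ox tw y z).
Proof.
case: cs => _ _ _ cocy; rewrite {1}/twist_mul.
transitivity (\tsum_(x1 \ox x2 <- D x) \tsum_(y1 \ox y2 <- D y)
   s (x1 \ox y1) * s (m x2 y2 \ox z)); first by sw.
by rewrite cocy /twist_mul; sw.
Qed.

Lemma twistA : associative tw.
Proof.
move=> x y z.
transitivity (\tsum_(x1 \ox x2 <- D x) \tsum_(u1 \ox u2 <- D (tw y z))
  s (x1 \ox u1) *: m x2 u2); first by [].
transitivity (\tsum_(u1 \ox u2 <- D (tw x y)) \tsum_(z1 \ox z2 <- D z)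
  s (u1 \ox z1) *: m u2 z2); last by [].
by sw; rewrite cocycle_twist ?mA.
Qed.

Lemma twist1l : left_id one tw.
Proof.
move=> x; rewrite /twist_mul; etransitivity; [nf|].
by under eq_tlift do rewrite cocycle1l ?m1l; etransitivity; [nf|].
Qed.

Lemma twist1r : right_id one tw.
Proof.
move=> x; rewrite /twist_mul; etransitivity; [nf|].
by under eq_tlift do rewrite cocycle1r ?m1r; etransitivity; [nf|].
Qed.

Lemma one_neq0 : one != 0.
Proof.
apply/eqP => one0; have := eps1; rewrite one0 (lin0 eps_lin) => /eqP.
by rewrite eq_sym oner_eq0.
Qed.

Lemma coinvariantP x : D x = x \ox one <-> exists a : K, x = a *: one.
Proof.
split=> [Dx|[a ->]]; last by rewrite (linZ _ _ D_lin) D1 (linZ _ _ (@lin_tpurel _ _ _ _)).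
exists (eps x); have E : \tsum_(x1 \ox x2 <- D x) eps x1 *: x2 = x.
  by etransitivity; [nf|].
by rewrite -{1}E Dx tlift_pureE //; lin.
Qed.

Section TwistInverse.
Variable t : tensor B B -> K.
Hypothesis lt : @lin K _ K^o t.
Hypothesis st : convolution_inverse (@comulBB K B) (@counitBB K B) *%R (1 : K^o) s t.

Hint Resolve lt : lin.

Lemma cocycle_inverse_l x y : \tsum_(x1 \ox x2 <- D x) \tsum_(y1 \ox y2 <- D y)
  t (x1 \ox y1) * s (x2 \ox y2) = eps x * eps y.
Proof.
rewrite -counitBBE -[RHS]mulr1; transitivity (counitBB (x \ox y) *: (1 : K^o)) => //.
by rewrite -(st _).2 /convolution; sw.
Qed.

(** The classical inverse s^(-1)(S(x_(2)), x_(3)) S(x_(1)) of the canonical section of a twist. *)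
Definition twist_inverse (x : B) : B :=
  \tsum_(x1 \ox y <- D x) \tsum_(x2 \ox x3 <- D y) t (S x2 \ox x3) *: S x1.

Lemma twist_inverse_lin : lin twist_inverse.
Proof. by rewrite /twist_inverse; lin. Qed.
Hint Resolve twist_inverse_lin : lin.

Lemma comul_twist_inverse x :
  D (twist_inverse x) = \tsum_(x1 \ox x2 <- D x) twist_inverse x2 \ox S x1.
Proof. by rewrite /twist_inverse; sw. Qed.
Hint Extern 0 (D (twist_inverse _) = _) => exact: comul_twist_inverse : sweedler.

Lemma twist_inverse_l x : convolution D tw twist_inverse id x = eps x *: one.
Proof.
rewrite /convolution.
(* Anticomultiplicativity of S lets the [t] of [twist_inverse] and the [s] of the product combine
   into (t * s)(S(x_(2)), x_(3)), which is a counit. *)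
transitivity (\tsum_(x1 \ox y <- D x) \tsum_(z \ox x4 <- D y) \tsum_(u \ox v <- D z)
  (\tsum_(u1 \ox u2 <- D (S u)) \tsum_(v1 \ox v2 <- D v)
    t (u1 \ox v1) * s (u2 \ox v2)) *: m (S x1) x4).
  by rewrite /twist_inverse /twist_mul; sw.
under eq_tlift do under eq_tlift do under eq_tlift do rewrite cocycle_inverse_l eps_S.
transitivity (\tsum_(x1 \ox x2 <- D x) m (S x1) x2); last exact: S_l.
by sw.
Qed.

Definition twist_defect (x : B) : B := convolution D tw id twist_inverse x.

(* [twist_defect] is coinvariant, hence scalar-valued, and convolving it with [id]
   gives [id]. *)
Lemma twist_inverse_r x : convolution D tw id twist_inverse x = eps x *: one.
Proof.
have PE y : exists a : K, twist_defect y = a *: one.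
  apply/coinvariantP; rewrite /twist_defect /convolution.
  transitivity (\tsum_(x1 \ox y' <- D y) \tsum_(z \ox x4 <- D y')
    \tsum_(x2 \ox x3 <- D z) tw x1 (twist_inverse x4) \ox m x2 (S x3)); first by sw.
  transitivity (\tsum_(x1 \ox y' <- D y) \tsum_(z \ox x4 <- D y')
    eps z *: (tw x1 (twist_inverse x4) \ox one)).
    apply: eq_tlift => x1 y'; apply: eq_tlift => z x4.
    by apply: (convE (F := fun b => tw x1 (twist_inverse x4) \ox b) _ S_r); lin.
  by sw.
have PE' y : twist_defect y = eps (twist_defect y) *: one.
  by have [a ->] := PE y; rewrite (linZK _ _ eps_lin) eps1 mulr1.
have lP : lin twist_defect by rewrite /twist_defect /convolution; lin.
have Pid y : \tsum_(x1 \ox x2 <- D y) tw (twist_defect x1) x2 = y.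
  transitivity (\tsum_(x1 \ox x2 <- D y) tw x1 (convolution D tw twist_inverse id x2)).
    by rewrite /twist_defect /convolution; sw; rewrite ?twistA.
  under eq_tlift do rewrite twist_inverse_l (linZ _ _ (twist_linr _)) twist1r.
  by etransitivity; [nf|].
rewrite -/(twist_defect x) PE'; congr (_ *: _); rewrite -{2}(Pid x).
under [in RHS]eq_tlift do rewrite PE' (linZ _ _ (twist_linl _)) twist1l.
by symmetry; etransitivity; [nf|].
Qed.

End TwistInverse.

Theorem twist_cleft : cleft_pair (twist_pair s).
Proof.
have sec : @Bsection K B (twist_pair s) id.
  split=> //=; first by move=> x; rewrite tlift_tpure.
  case: cs => _ [t lt st] _ _; exists (twist_inverse t).
    exact: twist_inverse_lin.
  by move=> x; split; [exact: twist_inverse_r | exact: twist_inverse_l].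
split=> //; split=> /=; last by exists id.
- split; last exact: coalgebra_right_comodule.
  split; [|exact: twistA|exact: twist1l|exact: twist1r|exact: one_neq0].
  by apply/blinP; split; [exact: twist_linl | exact: twist_linr].
- exact: D1.
- exact: comul_twist.
- exact: coinvariantP.
Qed.

End Twist.
End HopfB.

(** * Smash products and bosonization *)

Section YdAct.
Variables (K : fieldType) (H : hopfAlgebra K) (R : ydHopfAlgebra H).

(* The Yetter-Drinfeld condition in its antipode-free form. *)
Lemma yd_coact_actE (U : lmodType K) (F : H -> R -> U) h r : blin F ->
  \tsum_(h1 \ox h2 <- hcomul h) \tsum_(d \ox w <- yd_coact (yd_act h1 r)) F (d * h2) w =
  \tsum_(h1 \ox h2 <- hcomul h) \tsum_(c \ox w <- yd_coact r) F (h1 * c) (yd_act h2 w).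
Proof.
case=> F1 F2.
transitivity (\tsum_(p \ox h' <- hcomul h) \tsum_(q \ox z <- hcomul h')
  \tsum_(c \ox w <- yd_coact r) \tsum_(s \ox t <- hcomul z)
    F (p * c * (hantipode s * t)) (yd_act q w)); first by sw; rewrite !mulrA.
transitivity (\tsum_(p \ox h' <- hcomul h) \tsum_(q \ox z <- hcomul h')
  \tsum_(c \ox w <- yd_coact r) hcounit z *: F (p * c * 1) (yd_act q w)).
  do 3! (apply: eq_tlift => ? ?).
  by apply: (hantipode_lE (F := fun b => F (_ * _ * b) _)); lin.
by sw; rewrite ?mulr1.
Qed.

End YdAct.

Section Smash.
Variables (K : fieldType) (H : hopfAlgebra K) (R : ydHopfAlgebra H).
Variables (E : algType K) (act : H -> E -> E).
Hypothesis actE : hmodule_algebra act.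

Lemma hact_linr h : lin (act h).
Proof. by case: actE => -[[_ +] _ _] _ _; apply. Qed.
Lemma hact_linl e : lin (act^~ e).
Proof. by case: actE => -[[+ _] _ _] _ _; apply. Qed.
Lemma hact1 e : act 1 e = e. Proof. by case: actE => -[_ + _] _ _; apply. Qed.
Lemma hactA h k e : act (h * k) e = act h (act k e).
Proof. by case: actE => -[_ _ +] _ _; apply. Qed.
Lemma hact_1 h : act h 1 = hcounit h *: 1. Proof. by case: actE => _ + _; apply. Qed.
Lemma hact_mul h e f : act h (e * f) =
  \tsum_(h1 \ox h2 <- hcomul h) act h1 e * act h2 f.
Proof. by case: actE => _ _ +; apply. Qed.

Hint Resolve hact_linr hact_linl : lin.
Hint Rewrite hact1 hactA hact_1 hact_mul : leafsum.

Local Notation M := (smash_mul act).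

Lemma smash_mulE e h f k : M (e \ox h) (f \ox k) =
  \tsum_(h1 \ox h2 <- hcomul h) (e * act h1 f) \ox (h2 * k).
Proof. by rewrite /smash_mul tlift_pureE; [rewrite tlift_pureE //; lin | lin]. Qed.

Lemma smash_linl y : lin (M^~ y). Proof. by rewrite /smash_mul; lin. Qed.
Lemma smash_linr x : lin (M x). Proof. by rewrite /smash_mul; lin. Qed.
Hint Resolve smash_linl smash_linr : lin.

Lemma smash_mulA : associative M.
Proof.
move=> s t u; move: s; apply: tensor_ext; [lin | lin | move=> e b].
move: t; apply: tensor_ext; [lin | lin | move=> f c].
move: u; apply: tensor_ext; [lin | lin | move=> h d].
by rewrite /smash_mul; sw; rewrite !mulrA.
Qed.

Lemma smash_mul1l : left_id (1 \ox 1) M.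
Proof.
apply: tensor_ext; [lin | lin | move=> e h].
by rewrite /smash_mul; sw; rewrite ?mul1r.
Qed.

Lemma smash_mul1r : right_id (1 \ox 1) M.
Proof.
apply: tensor_ext; [lin | lin | move=> e h].
by rewrite /smash_mul; sw; rewrite ?mulr1.
Qed.

Lemma smash_ualg : ualg M (1 \ox 1).
Proof.
split; [|exact: smash_mulA|exact: smash_mul1l|exact: smash_mul1r].
by split; [exact: smash_linl | exact: smash_linr].
Qed.

End Smash.

Section SmashCoaction.
Variables (K : fieldType) (H : hopfAlgebra K) (R : ydHopfAlgebra H).
Variables (E : algType K) (act : H -> E -> E).
Hypothesis actE : hmodule_algebra act.
Let act_linr := hact_linr actE.
Let act_linl := hact_linl actE.
Let M_linl := smash_linl actE.
Let M_linr := smash_linr actE.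
Let MR_linl := smash_linl (yd_module_algebra R).
Let MR_linr := smash_linr (yd_module_algebra R).
Let act1 := hact1 actE.
Let actA := hactA actE.
Let act_1 := hact_1 actE.
Let act_mul := hact_mul actE.
Hint Resolve act_linr act_linl M_linl M_linr MR_linl MR_linr : lin.
Hint Rewrite act1 actA act_1 act_mul : leafsum.
Variable rho : E -> tensor E R.
Hypothesis comE : right_comodule (@yd_comul K H R) (@yd_counit K H R) rho.
Hypothesis rho_act : forall h e, rho (act h e) =
  \tsum_(h1 \ox h2 <- hcomul h) \tsum_(e0 \ox e1 <- rho e) act h1 e0 \ox yd_act h2 e1.
Hypothesis rho1 : rho 1 = 1 \ox 1.
Hypothesis rhoM : forall e e', rho (e * e') =
  \tsum_(e0 \ox e1 <- rho e) \tsum_(f0 \ox f1 <- rho e')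
  \tsum_(c \ox r0 <- yd_coact e1) (e0 * act c f0) \ox (r0 * f1).

Lemma hrho_lin : lin rho. Proof. by case: comE. Qed.
Hint Resolve hrho_lin : lin.
Hint Resolve comE : coalg.
Hint Extern 0 (rho _ = _) => exact: rho_act : sweedler.
Hint Extern 0 (rho _ = _) => exact: rho1 : sweedler.
Hint Extern 0 (rho _ = _) => exact: rhoM : sweedler.

(** Kept separate from [RcleftPair] so as to cover also E = R with [rho] the comultiplication, where
    it is convertible to [boson_comul]. *)
Definition smash_rho (x : tensor E H) : tensor (tensor E H) (tensor R H) :=
  \tsum_(e \ox h <- x) \tsum_(e0 \ox e1 <- rho e)
  \tsum_(h1 \ox h2 <- hcomul h) \tsum_(c \ox r <- yd_coact e1)
    (e0 \ox (c * h1)) \ox (r \ox h2).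

Lemma smash_rho_lin : lin smash_rho. Proof. by rewrite /smash_rho; lin. Qed.
Hint Resolve smash_rho_lin : lin.

Lemma smash_rhoE e h : smash_rho (e \ox h) =
  \tsum_(e0 \ox e1 <- rho e) \tsum_(h1 \ox h2 <- hcomul h) \tsum_(c \ox r <- yd_coact e1)
    (e0 \ox (c * h1)) \ox (r \ox h2).
Proof. by rewrite /smash_rho tlift_pureE //; lin. Qed.
Hint Extern 0 (smash_rho _ = _) => exact: smash_rhoE : sweedler.

Lemma boson_comulE r h : boson_comul (r \ox h : tensor R H) =
  \tsum_(r1 \ox r2 <- yd_comul r) \tsum_(h1 \ox h2 <- hcomul h)
  \tsum_(c \ox r0 <- yd_coact r2) (r1 \ox (c * h1)) \ox (r0 \ox h2).
Proof. by rewrite /boson_comul tlift_pureE //; lin. Qed.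
Hint Extern 0 (boson_comul _ = _) => exact: boson_comulE : sweedler.

Lemma boson_counitE r h : boson_counit (r \ox h : tensor R H) = yd_counit r * hcounit h.
Proof. by rewrite /boson_counit (@tlift_pureE _ K^o) //; lin. Qed.
Hint Rewrite boson_counitE : leaf.

Lemma boson_comul_lin : lin (@boson_comul K H R). Proof. by rewrite /boson_comul; lin. Qed.
Lemma boson_counit_lin : @lin K _ K^o (@boson_counit K H R).
Proof. by apply: (@lin_tlift _ _ _ K^o); lin. Qed.
Hint Resolve boson_comul_lin boson_counit_lin : lin.

Lemma smash_right_comodule :
  right_comodule (@boson_comul K H R) (@boson_counit K H R) smash_rho.
Proof.
split; first exact: smash_rho_lin.
- apply: tensor_ext; [lin | lin | move=> e h].
  by sw; rewrite !mulrA.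
- apply: tensor_ext; [lin | lin | move=> e h].
  by sw.
Qed.

Lemma smash_rho1 : smash_rho (1 \ox 1) = (1 \ox 1) \ox (1 \ox 1).
Proof. by sw; rewrite mulr1. Qed.

(** Beyond normalisation this takes one use of [yd_coact_actE]: on the left H acts on [f1] before
    the coaction is taken, on the right after it. *)
Lemma smash_rhoM x y : smash_rho (smash_mul act x y) =
  \tsum_(x0 \ox x1 <- smash_rho x) \tsum_(y0 \ox y1 <- smash_rho y)
    smash_mul act x0 y0 \ox smash_mul (@yd_act K H R) x1 y1.
Proof.
move: x; apply: tensor_ext; [lin | lin | move=> e h].
move: y; apply: tensor_ext; [lin | lin | move=> f k].
transitivity (\tsum_(e0 \ox e1 <- rho e) \tsum_(h1 \ox h' <- hcomul h)
  \tsum_(f0 \ox f1 <- rho f) \tsum_(c \ox r <- yd_coact e1)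
  \tsum_(c1 \ox c2 <- hcomul c) \tsum_(k1 \ox k2 <- hcomul k)
  \tsum_(ha \ox hb <- hcomul h')
  \tsum_(p \ox q <- hcomul ha) \tsum_(d \ox w <- yd_coact (yd_act p f1))
    (fun z w => ((e0 * act c1 (act h1 f0)) \ox (c2 * (z * k1)))
       \ox ((r * w) \ox (hb * k2))) (d * q) w).
  by rewrite (smash_mulE actE); sw; rewrite !mulrA.
transitivity (\tsum_(e0 \ox e1 <- rho e) \tsum_(h1 \ox h' <- hcomul h)
  \tsum_(f0 \ox f1 <- rho f) \tsum_(c \ox r <- yd_coact e1)
  \tsum_(c1 \ox c2 <- hcomul c) \tsum_(k1 \ox k2 <- hcomul k)
  \tsum_(ha \ox hb <- hcomul h')
  \tsum_(p \ox q <- hcomul ha) \tsum_(d \ox w <- yd_coact f1)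
    (fun z w => ((e0 * act c1 (act h1 f0)) \ox (c2 * (z * k1)))
       \ox ((r * w) \ox (hb * k2))) (p * d) (yd_act q w)).
  apply: eq_tlift => e0 e1; apply: eq_tlift => h1 h'; apply: eq_tlift => f0 f1.
  apply: eq_tlift => c r; apply: eq_tlift => c1 c2; apply: eq_tlift => k1 k2.
  apply: eq_tlift => ha hb.
  by apply: (yd_coact_actE (F := fun z w => ((e0 * act c1 (act h1 f0)) \ox (c2 * (z * k1)))
    \ox ((r * w) \ox (hb * k2)))); lin.
by rewrite /smash_mul; sw; rewrite !mulrA.
Qed.

Local Notation M := (smash_mul act).

(** Brings the H-components of neighbouring factors together, where the antipode axiom can act on
    them. *)
Lemma smash_mul_fuse e a b z :
  M (e \ox a) (M (1 \ox b) z) = M (e \ox 1) (M (1 \ox (a * b)) z).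
Proof.
rewrite !(smash_mulA actE); congr (M _ _).
by rewrite !(smash_mulE actE); sw; rewrite mulr1.
Qed.

Lemma smash_mul1 e f k : M (e \ox 1) (f \ox k) = (e * f) \ox k.
Proof. by rewrite (smash_mulE actE); sw; rewrite mul1r. Qed.

Lemma smash_mul1h h k : M (1 \ox h) (1 \ox k) = 1 \ox (h * k).
Proof. by rewrite (smash_mulE actE); sw; rewrite ?mulr1. Qed.

Section Inverse.
Variables g g' : R -> E.
Hypotheses (lg : lin g) (lg' : lin g').
Hint Resolve lg lg' : lin.

(** For E = R and [g'] the antipode of R this is Radford's antipode of R # H. *)
Definition smash_inverse (x : tensor R H) : tensor E H :=
  \tsum_(r \ox h <- x) \tsum_(c \ox r0 <- yd_coact r)
    M (1 \ox hantipode (c * h)) (g' r0 \ox 1).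

Definition smash_ext (x : tensor R H) : tensor E H := \tsum_(r \ox h <- x) g r \ox h.

Lemma smash_inverse_lin : lin smash_inverse. Proof. by rewrite /smash_inverse; lin. Qed.
Lemma smash_ext_lin : lin smash_ext. Proof. by rewrite /smash_ext; lin. Qed.
Hint Resolve smash_inverse_lin smash_ext_lin : lin.

Lemma smash_extE r h : smash_ext (r \ox h) = g r \ox h.
Proof. by rewrite /smash_ext tlift_pureE //; lin. Qed.

Local Notation right_inverse :=
  (forall r, convolution (@yd_comul K H R) *%R g g' r = yd_counit r *: 1).
Local Notation left_inverse :=
  (forall r, convolution (@yd_comul K H R) *%R g' g r = yd_counit r *: 1).

Lemma smash_ext_inverse_r x : right_inverse ->
  convolution (@boson_comul K H R) M smash_ext smash_inverse x = boson_counit x *: (1 \ox 1).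
Proof.
move=> gg'_r.
move: x; apply: tensor_ext; [rewrite /convolution; lin | lin | move=> r h].
transitivity (\tsum_(r1 \ox r2 <- yd_comul r) \tsum_(h1 \ox h2 <- hcomul h)
   \tsum_(c \ox r0 <- yd_coact r2) \tsum_(d \ox s <- yd_coact r0)
   M (g r1 \ox (c * h1)) (M (1 \ox hantipode (d * h2)) (g' s \ox 1))).
  by rewrite /convolution /smash_ext /smash_inverse; sw.
under eq_tlift do under eq_tlift do under eq_tlift do under eq_tlift do
  rewrite smash_mul_fuse.
transitivity (\tsum_(r1 \ox r2 <- yd_comul r) \tsum_(c \ox r0 <- yd_coact r2)
   \tsum_(a \ox b <- hcomul (c * h))
   M (g r1 \ox 1) (M (1 \ox (a * hantipode b)) (g' r0 \ox 1))); first by sw.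
transitivity (\tsum_(r1 \ox r2 <- yd_comul r) \tsum_(c \ox r0 <- yd_coact r2)
   hcounit (c * h) *: M (g r1 \ox 1) (M (1 \ox 1) (g' r0 \ox 1))).
  apply: eq_tlift => r1 r2; apply: eq_tlift => c r0.
  by apply: (hantipode_rE (F := fun a => M (g r1 \ox 1) (M (1 \ox a) (g' r0 \ox 1)))); lin.
transitivity (\tsum_(r1 \ox r2 <- yd_comul r) hcounit h *: ((g r1 * g' r2) \ox (1 : H))).
  under eq_tlift do under eq_tlift do rewrite (smash_mul1l actE) smash_mul1.
  by sw.
rewrite (convE (F := fun e : E => hcounit h *: (e \ox (1 : H))) _ gg'_r); last lin.
by rewrite scalerA boson_counitE.
Qed.

(** Isolates the convolution g' * g over R, so that the left inverse law can be passed from R to R #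
    H and also back. *)
Lemma smash_inverse_extE r h :
  convolution (@boson_comul K H R) M smash_inverse smash_ext (r \ox h) =
  \tsum_(h1 \ox h2 <- hcomul h) \tsum_(c \ox r0 <- yd_coact r)
   M (1 \ox hantipode (c * h1)) (convolution (@yd_comul K H R) *%R g' g r0 \ox h2).
Proof.
transitivity (\tsum_(r1 \ox r2 <- yd_comul r) \tsum_(h1 \ox h2 <- hcomul h)
   \tsum_(c \ox r0 <- yd_coact r2) \tsum_(d \ox s <- yd_coact r1)
   M (M (1 \ox hantipode (d * (c * h1))) (g' s \ox 1)) (g r0 \ox h2)).
  by rewrite /convolution /smash_ext /smash_inverse; sw.
under eq_tlift do under eq_tlift do under eq_tlift do under eq_tlift do
  rewrite -(smash_mulA actE) smash_mul1.
by rewrite /convolution; sw; rewrite !mulrA.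
Qed.

Lemma smash_ext_inverse_l x : left_inverse ->
  convolution (@boson_comul K H R) M smash_inverse smash_ext x = boson_counit x *: (1 \ox 1).
Proof.
move=> gg'_l.
move: x; apply: tensor_ext; [rewrite /convolution; lin | lin | move=> r h].
rewrite smash_inverse_extE.
under eq_tlift do under eq_tlift do rewrite gg'_l.
transitivity (\tsum_(h1 \ox h2 <- hcomul h) \tsum_(c \ox r0 <- yd_coact r)
   yd_counit r0 *: M (1 \ox hantipode (c * h1)) (1 \ox h2)); first by sw.
under eq_tlift do under eq_tlift do rewrite smash_mul1h.
transitivity (\tsum_(h1 \ox h2 <- hcomul h)
  yd_counit r *: (1 \ox (hantipode h1 * h2) : tensor E H)); first by sw.
rewrite (hantipode_lE (F := fun a => yd_counit r *: ((1 : E) \ox a))); last lin.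
by rewrite scalerA mulrC boson_counitE.
Qed.

(** With Q = g' * g, the hypothesis at r # 1 only says that S(r_(-1)) Q(r_(0)) is the counit of r.
    Replacing r by r_(0), multiplying by r_(-1) in front and cancelling the antipode frees Q. *)
Lemma left_inverse_of_smash :
  (forall x, convolution (@boson_comul K H R) M smash_inverse smash_ext x
     = boson_counit x *: (1 \ox 1)) -> left_inverse.
Proof.
move=> inv r; pose Q := convolution (@yd_comul K H R) *%R g' g.
have lQ : lin Q by rewrite /Q /convolution; lin.
pose P (z : tensor E H) : E := \tsum_(e \ox k <- z) hcounit k *: e.
have PE e : P (e \ox 1) = e by rewrite /P tlift_pureE ?hcounit1 ?scale1r //; lin.
have invQ s : \tsum_(c \ox r0 <- yd_coact s) M (1 \ox hantipode c) (Q r0 \ox 1)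
    = yd_counit s *: (1 \ox 1).
  have := inv (s \ox 1); rewrite smash_inverse_extE boson_counitE hcounit1 mulr1 => <-.
  by rewrite -/Q; sw.
rewrite -/Q -[LHS]PE -[RHS]PE; congr P.
transitivity (\tsum_(c \ox r0 <- yd_coact r) hcounit c *: M (1 \ox 1) (Q r0 \ox 1)).
  by sw; rewrite (smash_mul1l actE).
transitivity (\tsum_(c \ox r0 <- yd_coact r) \tsum_(a \ox b <- hcomul c)
   M (1 \ox (a * hantipode b)) (Q r0 \ox 1)).
  apply: eq_tlift => c r0; symmetry.
  by apply: (hantipode_rE (F := fun a => M (1 \ox a) (Q r0 \ox 1))); lin.
under eq_tlift do under eq_tlift do rewrite -smash_mul1h -(smash_mulA actE).
transitivity (\tsum_(a \ox r' <- yd_coact r) M (1 \ox a)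
   (\tsum_(b \ox r0 <- yd_coact r') M (1 \ox hantipode b) (Q r0 \ox 1))); first by sw.
under eq_tlift do rewrite invQ.
by sw; rewrite (smash_mul1l actE).
Qed.

(** Uniqueness of inverses on H (x) R: both sides are inverse to h (x) r |-> g(h.r), and H-linearity
    of [g] allows the regrouping. *)
Lemma hlinear_inverse : right_inverse -> left_inverse ->
  (forall h r, g (yd_act h r) = act h (g r)) -> forall h r, g' (yd_act h r) = act h (g' r).
Proof.
move=> gg'_r gg'_l gH h r.
transitivity (\tsum_(h1 \ox h2 <- hcomul h) \tsum_(r1 \ox r2 <- yd_comul r)
  g' (yd_act h1 r1) * act h2 (convolution (@yd_comul K H R) *%R g g' r2)).
  under [RHS]eq_tlift do under eq_tlift do rewrite gg'_r.
  by sw; rewrite mulr1.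
transitivity (\tsum_(h1 \ox h2 <- hcomul h) \tsum_(r1 \ox r2 <- yd_comul r)
  convolution (@yd_comul K H R) *%R g' g (yd_act h1 r1) * act h2 (g' r2)).
  rewrite /convolution; sw.
  by rewrite gH mulrA.
under eq_tlift do under eq_tlift do rewrite gg'_l yd_counit_act.
by sw; rewrite mul1r.
Qed.

End Inverse.

Lemma tensor_one_neq0 : (1 \ox 1 : tensor E H) != 0.
Proof.
apply/eqP => one0.
have lf : lin (fun x : tensor E H => \tsum_(e \ox h <- x) hcounit h *: e) by lin.
have := congr1 (fun x : tensor E H => \tsum_(e \ox h <- x) hcounit h *: e) one0.
rewrite /= (lin0 lf) tlift_pureE; last lin.
by rewrite hcounit1 scale1r => /eqP; rewrite oner_eq0.
Qed.

Lemma smash_coinvariantP (x : tensor E H) :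
  (forall e, rho e = e \ox 1 <-> exists a : K, e = a%:A) ->
  smash_rho x = x \ox (1 \ox 1) <-> exists a : K, x = a *: (1 \ox 1).
Proof.
move=> coinv; split=> [rx|[a ->]]; last first.
  by rewrite (linZ _ _ smash_rho_lin) smash_rho1 (linZ _ _ (@lin_tpurel _ _ _ _)).
(* Keeping the E- and last H-components recovers x from [smash_rho x], but gives [P x \ox 1] on x
   (x) 1; hence x has trivial H-component. *)
pose L1 (z : tensor (tensor E H) (tensor R H)) : tensor E H :=
  \tsum_(z \ox y <- z) \tsum_(e \ox k <- z) \tsum_(r \ox h <- y)
     (hcounit k * yd_counit r) *: (e \ox h).
pose P (z : tensor E H) : E := \tsum_(e \ox k <- z) hcounit k *: e.
have xE : x = P x \ox 1.
  transitivity (L1 (smash_rho x)).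
    rewrite /L1; move: {rx} x; apply: tensor_ext; [lin | lin | move=> e h]; by sw.
  by rewrite rx /L1 /P; sw.
(* Keeping the E- and R-components turns coinvariance over R # H into coinvariance of [P x] over
   R. *)
pose L2 (z : tensor (tensor E H) (tensor R H)) : tensor E R :=
  \tsum_(z \ox y <- z) \tsum_(e \ox k <- z) \tsum_(r \ox h <- y)
     (hcounit k * hcounit h) *: (e \ox r).
have rhoP : rho (P x) = P x \ox 1.
  transitivity (L2 (smash_rho (P x \ox 1))); first by rewrite /L2; move: (P x) => e; sw.
  by rewrite -xE rx {1}xE /L2; move: (P x) => e; sw.
have [a Pa] := (coinv (P x)).1 rhoP.
by exists a; rewrite xE Pa (linZ _ _ (@lin_tpurel _ _ _ _)).
Qed.

End SmashCoaction.

#[export] Hint Rewrite boson_counitE : leaf.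
#[export] Hint Resolve boson_comul_lin boson_counit_lin : lin.
#[export] Hint Extern 0 (boson_comul _ = _) => exact: boson_comulE : sweedler.

(** * R # H as a Hopf algebra and E # H as a cleft object over it *)

Section Boson.
Variables (K : fieldType) (H : hopfAlgebra K) (R : ydHopfAlgebra H).

Definition boson_antipode : boson R -> boson R :=
  smash_inverse (@yd_act K H R) (@yd_antipode K H R).

Let R_comodule : right_comodule (@yd_comul K H R) (@yd_counit K H R) (@yd_comul K H R).
Proof. by case: (yd_coalgebra R). Qed.

Lemma smash_ext_id : @smash_ext K H R R id =1 id.
Proof. by move=> x; exact: tlift_tpure. Qed.

Lemma boson_coalgebra : coalgebra (@boson_comul K H R) (@boson_counit K H R).
Proof.
have [lD coA coU] := smash_right_comodule R_comodule.
split; [exact: lD | exact: boson_counit_lin | exact: coA | | exact: coU].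
apply: tensor_ext; [lin | lin | move=> r h].
by sw.
Qed.

(** R coacts on itself with section [id], inverted by its antipode, so the facts on E # H apply with
    E = R; multiplicativity of the counit is checked directly. *)
Lemma boson_hopf : hopf_axioms boson_antipode.
Proof.
have actR := yd_module_algebra R.
split.
- exact: boson_coalgebra.
- exact: smash_ualg.
- exact: (smash_rhoM actR R_comodule
  (@yd_comul_act K H R)  (@yd_comulM K H R)).
- exact: (smash_rho1 R_comodule (@yd_comul1 K H R)).
- have lml y := smash_linl (yd_module_algebra R) y.
  have lmr x := smash_linr (yd_module_algebra R) x.
  move=> x y; move: x.
  apply: (@tensor_ext _ _ _ K^o); [rewrite /=; lin | rewrite /=; lin | move=> r h].
  move: y.
  apply: (@tensor_ext _ _ _ K^o); [rewrite /=; lin | rewrite /=; lin | move=> s k].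
  rewrite /= (smash_mulE (yd_module_algebra R)) !boson_counitE.
  by etransitivity; [nf | rewrite !mulrA].
- by rewrite /= boson_counitE yd_counit1 hcounit1 mulr1.
- by apply: smash_inverse_lin => //; exact: yd_antipode_linear.
- have lA : lin (@yd_antipode K H R) := @yd_antipode_linear K H R.
  have AP := @yd_antipodeP K H R; have lid : @lin K R R id by [].
  move=> x; split.
    rewrite -(smash_ext_inverse_r actR lid lA _ (fun r => (AP r).1)).
    by apply: eq_tlift => x1 x2; rewrite smash_ext_id.
  rewrite -(smash_ext_inverse_l actR lid lA _ (fun r => (AP r).2)).
  by apply: eq_tlift => x1 x2; rewrite smash_ext_id.
Qed.

Lemma smash_cleft (E : RcleftPair R) : cleft_pair (smash_pair E).
Proof.
case: E => E act rho g cl sec.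
have [[actE comE rho_act] rho1 rhoM coinv _] := cl.
have [[lg g_act] rho_g [g' [lg' g'_act gg']] g1] := sec.
have sec' : @Bsection K (boson R) (smash_pair (MkRcleftPair cl sec))
    (@smash_section _ _ _ (MkRcleftPair cl sec)).
  split.
  - exact: (smash_ext_lin lg).
  - have lg1 : lin g := lg; have lrho := hrho_lin comE.
    have lsr := smash_rho_lin comE; have lse := smash_ext_lin lg1.
    have srE := smash_rhoE comE; have seE := smash_extE lg1.
    move=> x; rewrite -[LHS]/(smash_rho rho (smash_ext g x)).
    rewrite -[RHS]/(\tsum_(x1 \ox x2 <- @boson_comul K H R x) smash_ext g x1 \ox x2).
    move: x; apply: tensor_ext; [lin | lin | move=> r h].
    by rewrite seE srE boson_comulE; sw; rewrite seE.
  - exists (smash_inverse act g'); first exact: smash_inverse_lin.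
    by move=> x; split; 
      [apply: smash_ext_inverse_r | apply: smash_ext_inverse_l] => // r;
      [exact: (gg' r).1 | exact: (gg' r).2].
  - by rewrite /smash_section /= tlift_pureE ?g1 //; lin.
split=> //; split.
- split; last exact: (smash_right_comodule comE).
  have [/blinP bM MA M1l M1r] := smash_ualg actE.
  by split=> //; exact: tensor_one_neq0.
- exact: (smash_rho1 comE rho1).
- exact: (smash_rhoM actE comE rho_act rhoM).
- by move=> x; apply: (smash_coinvariantP comE rho1).
- by exists (@smash_section _ _ _ (MkRcleftPair cl sec)).
Qed.

End Boson.

(** * Cocycles induced from the Yetter-Drinfeld side *)

Section Phi.
Variables (K : fieldType) (H : hopfAlgebra K) (R : ydHopfAlgebra H).
Implicit Types p q : tensor R R -> K.
Local Notation act := (@yd_act K H R).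
Let MR_linl := smash_linl (yd_module_algebra R).
Let MR_linr := smash_linr (yd_module_algebra R).
Hint Resolve MR_linl MR_linr : lin.

Lemma comulRRE (r s : R) : comulRR (r \ox s) =
  \tsum_(r1 \ox r2 <- yd_comul r) \tsum_(s1 \ox s2 <- yd_comul s)
  \tsum_(c \ox r0 <- yd_coact r2) (r1 \ox act c s1) \ox (r0 \ox s2).
Proof. by rewrite /comulRR tlift_pureE //; lin. Qed.

Lemma comulRR_lin : lin (@comulRR K H R). Proof. by rewrite /comulRR; lin. Qed.

Lemma counitRRE (r s : R) : counitRR (r \ox s) = yd_counit r * yd_counit s.
Proof. by rewrite /counitRR (@tlift_pureE _ K^o) //; lin. Qed.

Lemma counitRR_lin : @lin K _ K^o (@counitRR K H R).
Proof. by apply: (@lin_tlift _ _ _ K^o); lin. Qed.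
Hint Resolve comulRR_lin counitRR_lin : lin.
Hint Extern 0 (comulRR _ = _) => exact: comulRRE : sweedler.

Section LinearForm.
Variable p : tensor R R -> K.
Hypothesis lp : @lin K _ K^o p.
Hint Resolve lp : lin.

Lemma Phi_lin : @lin K _ K^o (Phi p).
Proof. by apply: (@lin_tlift _ _ _ K^o); lin. Qed.

Lemma PhiE (r r' : R) (h h' : H) :
  Phi p ((r \ox h : boson R) \ox (r' \ox h' : boson R)) = p (r \ox act h r') * hcounit h'.
Proof.
rewrite /Phi (@tlift_pureE _ K^o); last lin.
rewrite (@tlift_pureE _ K^o); last lin.
by rewrite (@tlift_pureE _ K^o) //; lin.
Qed.

Definition Zleft (r s t : R) : K :=
  \tsum_(r1 \ox r2 <- yd_comul r) \tsum_(s1 \ox s2 <- yd_comul s)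
  \tsum_(c \ox r0 <- yd_coact r2) p (r1 \ox act c s1) * p ((r0 * s2) \ox t).

Definition Zright (r s t : R) : K :=
  \tsum_(s1 \ox s2 <- yd_comul s) \tsum_(t1 \ox t2 <- yd_comul t)
  \tsum_(c \ox s0 <- yd_coact s2) p (s1 \ox act c t1) * p (r \ox (s0 * t2)).
Hint Resolve Phi_lin : lin.

(** Together with [Phi_right] this writes the two sides of the cocycle identity on R # H as those of
    the Z(R) condition, both at r, h_(1).s and (h_(2)k).t. *)
Lemma Phi_left (r s t : R) (h k l : H) :
  \tsum_(x1 \ox x2 <- boson_comul (r \ox h)) \tsum_(y1 \ox y2 <- boson_comul (s \ox k))
    Phi p (x1 \ox y1 : tensor (boson R) (boson R))
      * Phi p (smash_mul act x2 y2 \ox (t \ox l) : tensor (boson R) (boson R)) =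
  (\tsum_(h1 \ox h2 <- hcomul h) Zleft r (act h1 s) (act (h2 * k) t)) * hcounit l.
Proof.
transitivity (\tsum_(r1 \ox r2 <- yd_comul r) \tsum_(s1 \ox s2 <- yd_comul s)
  \tsum_(c \ox r0 <- yd_coact r2) \tsum_(h1 \ox h' <- hcomul h) \tsum_(h2 \ox h3 <- hcomul h')
  (p (r1 \ox act c (act h1 s1)) * (p ((r0 * (act h2 s2)) \ox act (h3 * k) t) * hcounit l)));
  last by rewrite /Zleft; sw; rewrite mulrA.
transitivity (\tsum_(r1 \ox r2 <- yd_comul r) \tsum_(s1 \ox s2 <- yd_comul s)
  \tsum_(c \ox r0 <- yd_coact r2) \tsum_(h1 \ox h' <- hcomul h) \tsum_(d \ox s0 <- yd_coact s2)
  \tsum_(k1 \ox k2 <- hcomul k)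
   Phi p ((r1 \ox (c * h1) : boson R) \ox (s1 \ox (d * k1) : boson R))
     * Phi p (smash_mul act (r0 \ox h') (s0 \ox k2) \ox (t \ox l) : tensor (boson R) (boson R))).
  by sw.
under eq_tlift do under eq_tlift do under eq_tlift do under eq_tlift do under eq_tlift do
  under eq_tlift do rewrite PhiE (smash_mulE (yd_module_algebra R)).
transitivity (\tsum_(r1 \ox r2 <- yd_comul r) \tsum_(s1 \ox s2 <- yd_comul s)
  \tsum_(c \ox r0 <- yd_coact r2) \tsum_(h1 \ox h' <- hcomul h) \tsum_(h2 \ox h3 <- hcomul h')
  p (r1 \ox act c (act h1 s1))
    * Phi p (((r0 * act h2 s2) \ox (h3 * k) : boson R) \ox (t \ox l : boson R))).
  by sw.
do 5! (apply: eq_tlift => ? ?).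
by rewrite PhiE.
Qed.

Hypothesis hp : forall h r s, \tsum_(h1 \ox h2 <- hcomul h) p (act h1 r \ox act h2 s)
  = hcounit h * p (r \ox s).

(** The Yetter-Drinfeld condition moves h past the coaction of s; H-linearity of [p] then absorbs it
    in the first factor and leaves it acting on the product in the second. *)
Lemma Zright_act (r s t : R) (h : H) :
  \tsum_(h1 \ox h2 <- hcomul h) Zright r (act h1 s) (act h2 t) =
  \tsum_(s1 \ox s2 <- yd_comul s) \tsum_(t1 \ox t2 <- yd_comul t)
  \tsum_(c \ox s0 <- yd_coact s2) p (s1 \ox act c t1) * p (r \ox act h (s0 * t2)).
Proof.
transitivity (\tsum_(s1 \ox s2 <- yd_comul s) \tsum_(t1 \ox t2 <- yd_comul t)
  \tsum_(h1 \ox y <- hcomul h) \tsum_(z \ox h4 <- hcomul y)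
  \tsum_(u \ox v <- hcomul z) \tsum_(d \ox w <- yd_coact (act u s2))
   (fun a w => p (act h1 s1 \ox act a t1) * p (r \ox (w * act h4 t2)) : K^o) (d * v) w).
  by rewrite /Zright; sw.
transitivity (\tsum_(s1 \ox s2 <- yd_comul s) \tsum_(t1 \ox t2 <- yd_comul t)
  \tsum_(h1 \ox y <- hcomul h) \tsum_(z \ox h4 <- hcomul y)
  \tsum_(u \ox v <- hcomul z) \tsum_(d \ox w <- yd_coact s2)
   (fun a w => p (act h1 s1 \ox act a t1) * p (r \ox (w * act h4 t2)) : K^o) (u * d) (act v w)).
  apply: eq_tlift => s1 s2; apply: eq_tlift => t1 t2.
  apply: eq_tlift => h1 y; apply: eq_tlift => z h4.
  by apply: (yd_coact_actE (U := K^o)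
    (F := fun a w => p (act h1 s1 \ox act a t1) * p (r \ox (w * act h4 t2)))); lin.
transitivity (\tsum_(s1 \ox s2 <- yd_comul s) \tsum_(t1 \ox t2 <- yd_comul t)
  \tsum_(c \ox s0 <- yd_coact s2) \tsum_(z \ox h' <- hcomul h)
  (\tsum_(h1 \ox h2 <- hcomul z) p (act h1 s1 \ox act h2 (act c t1)))
    * p (r \ox act h' (s0 * t2))); first by sw.
under eq_tlift do under eq_tlift do under eq_tlift do under eq_tlift do rewrite hp.
by sw.
Qed.

Lemma Phi_right (r s t : R) (h k l : H) :
  \tsum_(x1 \ox x2 <- boson_comul (s \ox k)) \tsum_(y1 \ox y2 <- boson_comul (t \ox l))
    Phi p (x1 \ox y1 : tensor (boson R) (boson R))
      * Phi p ((r \ox h) \ox smash_mul act x2 y2 : tensor (boson R) (boson R)) =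
  (\tsum_(h1 \ox h2 <- hcomul h) Zright r (act h1 s) (act (h2 * k) t)) * hcounit l.
Proof.
under [in RHS]eq_tlift do rewrite yd_actA.
rewrite Zright_act.
transitivity (\tsum_(r1 \ox r2 <- yd_comul s) \tsum_(s1 \ox s2 <- yd_comul t)
  \tsum_(c \ox r0 <- yd_coact r2) \tsum_(h1 \ox h' <- hcomul k) \tsum_(d \ox s0 <- yd_coact s2)
  \tsum_(k1 \ox k2 <- hcomul l)
   Phi p ((r1 \ox (c * h1) : boson R) \ox (s1 \ox (d * k1) : boson R))
     * Phi p ((r \ox h) \ox smash_mul act (r0 \ox h') (s0 \ox k2) : tensor (boson R) (boson R))).
  by sw.
under eq_tlift do under eq_tlift do under eq_tlift do under eq_tlift do under eq_tlift do
  under eq_tlift do rewrite PhiE (smash_mulE (yd_module_algebra R)).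
transitivity (\tsum_(r1 \ox r2 <- yd_comul s) \tsum_(s1 \ox s2 <- yd_comul t)
  \tsum_(c \ox r0 <- yd_coact r2) \tsum_(h1 \ox h' <- hcomul k) \tsum_(h2 \ox h3 <- hcomul h')
  p (r1 \ox act c (act h1 s1))
    * Phi p ((r \ox h : boson R) \ox ((r0 * act h2 s2) \ox (h3 * l) : boson R))).
  by sw.
transitivity (\tsum_(r1 \ox r2 <- yd_comul s) \tsum_(s1 \ox s2 <- yd_comul t)
  \tsum_(c \ox r0 <- yd_coact r2) \tsum_(h1 \ox h' <- hcomul k) \tsum_(h2 \ox h3 <- hcomul h')
  (p (r1 \ox act c (act h1 s1)) * (p (r \ox act h (r0 * act h2 s2)) * (hcounit h3 * hcounit l)))).
  by do 5! (apply: eq_tlift => ? ?); rewrite PhiE hcounitM.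
by sw; rewrite !mulrA.
Qed.

End LinearForm.

(** The right-hand side is Phi of the convolution over R (x) R, so Phi is multiplicative. Inverse
    laws are carried along it in both directions. *)
Lemma Phi_convolutionE p q (r s : R) (h k : H) : @lin K _ K^o p -> @lin K _ K^o q ->
  convolution (@comulBB K (boson R)) *%R (Phi p : _ -> K^o) (Phi q)
    ((r \ox h : boson R) \ox (s \ox k : boson R))
  = convolution (@comulRR K H R) *%R (p : _ -> K^o) q (r \ox act h s) * hcounit k.
Proof.
move=> lp lq; have lP := Phi_lin lp; have lQ := Phi_lin lq.
have hB := boson_hopf R.
have cE x y : comulBB (x \ox y : tensor (boson R) (boson R)) =
    \tsum_(x1 \ox x2 <- boson_comul x) \tsum_(y1 \ox y2 <- boson_comul y)
      (x1 \ox y1 : tensor (boson R) (boson R)) \ox (x2 \ox y2 : tensor (boson R) (boson R)).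
  exact: comulBBE hB x y.
transitivity (\tsum_(r1 \ox r2 <- yd_comul r) \tsum_(s1 \ox s2 <- yd_comul s)
  \tsum_(c \ox r0 <- yd_coact r2) \tsum_(h1 \ox h2 <- hcomul h) \tsum_(d \ox s0 <- yd_coact s2)
  \tsum_(k1 \ox k2 <- hcomul k)
   Phi p ((r1 \ox (c * h1) : boson R) \ox (s1 \ox (d * k1) : boson R))
     * Phi q ((r0 \ox h2 : boson R) \ox (s0 \ox k2 : boson R))).
  by rewrite /convolution; sw.
under eq_tlift do under eq_tlift do under eq_tlift do under eq_tlift do under eq_tlift do
  under eq_tlift do rewrite !PhiE //.
by rewrite /convolution; sw; rewrite mulrA.
Qed.

Lemma Phi_convolution p q (z : tensor (boson R) (boson R)) :
  @lin K _ K^o p -> @lin K _ K^o q ->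
  (forall w, convolution (@comulRR K H R) *%R (p : _ -> K^o) q w = counitRR w *: (1 : K^o)) ->
  convolution (@comulBB K (boson R)) *%R (Phi p : _ -> K^o) (Phi q) z
    = counitBB z *: (1 : K^o).
Proof.
move=> lp lq pq; have lP := Phi_lin lp; have lQ := Phi_lin lq.
have hB := boson_hopf R.
have lc := comulBB_lin hB; have le := counitBB_lin hB.
move: z; apply: (@tensor_ext _ _ _ K^o); [rewrite /convolution; lin | lin | move=> x y].
rewrite (counitBBE hB).
move: x; apply: (@tensor_ext _ _ _ K^o); [rewrite /convolution; lin | rewrite /=; lin | move=> r h].
move: y; apply: (@tensor_ext _ _ _ K^o); [rewrite /convolution; lin | rewrite /=; lin | move=> s k].
rewrite Phi_convolutionE //.
rewrite pq counitRRE /= !boson_counitE yd_counit_act /GRing.scale /= !mulr1.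
by rewrite !mulrA.
Qed.

Lemma Phi_cocycle p : Z_R p -> two_cocycle (Phi p).
Proof.
case=> -[lp0 hp] [q [lq0 _] pq] p1 cocy.
have lp : @lin K _ K^o p := lp0; have lq : @lin K _ K^o q := lq0.
split; first exact: Phi_lin.
- exists (Phi q); first exact: Phi_lin.
  by move=> z; split; apply: Phi_convolution => // w; [exact: (pq w).1 | exact: (pq w).2].
- by rewrite /= PhiE // yd_act1 p1 hcounit1 mulr1.
have lP := Phi_lin lp; have hB := boson_hopf R.
have D_lin : lin (@bi_comul K (boson R)) by case: (ha_coalg hB).
have m_l y : lin ((@bi_mul K (boson R))^~ y) := ualg_linl (ha_alg hB) y.
have m_r x : lin (@bi_mul K (boson R) x) := ualg_linr (ha_alg hB) x.
move=> x y z.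
move: x; apply: (@tensor_ext _ _ _ K^o); [lin | lin | move=> r h].
move: y; apply: (@tensor_ext _ _ _ K^o); [lin | lin | move=> s k].
move: z; apply: (@tensor_ext _ _ _ K^o); [lin | lin | move=> t l].
rewrite [LHS](Phi_left lp) [RHS](Phi_right lp hp); congr (_ * _).
by apply: eq_tlift => h1 h2; rewrite /Zleft cocy.
Qed.

End Phi.

(** * From H-bilinear sections to elements of Z(R) *)

Section HBilinear.
Variables (K : fieldType) (H : hopfAlgebra K) (R : ydHopfAlgebra H).
Local Notation act := (@yd_act K H R).
Local Notation B := (boson R).
Local Notation m := (@bi_mul K B).
Local Notation D := (@bi_comul K B).
Local Notation eps := (@bi_counit K B).
Local Notation inH h := ((1 : R) \ox (h : H) : bi_space B).
Local Notation inR r := ((r : R) \ox (1 : H) : bi_space B).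

Let hB := boson_hopf R.
Let Dcoalg : coalgebra D eps. Proof. exact: ha_coalg hB. Qed.
Let D_lin : lin D. Proof. by case: Dcoalg. Qed.
Let eps_lin : @lin K B K^o eps. Proof. by case: Dcoalg. Qed.
Let m_linl y : lin (m^~ y). Proof. exact: ualg_linl (ha_alg hB) y. Qed.
Let m_linr x : lin (m x). Proof. exact: ualg_linr (ha_alg hB) x. Qed.
Let mA : associative m. Proof. by case: (ha_alg hB). Qed.
Let m1l : left_id (bi_one B) m. Proof. by case: (ha_alg hB). Qed.
Let m1r : right_id (bi_one B) m. Proof. by case: (ha_alg hB). Qed.
Let DM := ha_comulM hB.
Let epsM := ha_counitM hB.

Lemma bosonD_inH h : D (inH h) = \tsum_(h1 \ox h2 <- hcomul h) inH h1 \ox inH h2.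
Proof.
rewrite [LHS]boson_comulE; etransitivity; [nf|].
by apply: eq_tlift => h1 h2; rewrite ?mul1r.
Qed.

Lemma boson_eps_inH h : eps (inH h) = hcounit h.
Proof. by rewrite /= boson_counitE yd_counit1 mul1r. Qed.

Lemma boson_inR_inH r h : m (inR r) (inH h) = r \ox h.
Proof. by rewrite [LHS](smash_mulE (yd_module_algebra R)); sw; rewrite ?mulr1 ?mul1r. Qed.

Lemma boson_inH_inR r h : m (inH h) (inR r) =
  \tsum_(h1 \ox h2 <- hcomul h) act h1 r \ox h2.
Proof.
rewrite [LHS](smash_mulE (yd_module_algebra R)).
by apply: eq_tlift => h1 h2; rewrite mul1r mulr1.
Qed.

Hint Resolve D_lin eps_lin m_linl m_linr : lin.
Hint Resolve Dcoalg : coalg.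
Hint Extern 0 (D _ = _) => exact: bosonD_inH : sweedler.
Hint Extern 0 (D _ = _) => exact: DM : sweedler.
Hint Rewrite epsM boson_eps_inH : leaf.

(** Uniqueness of inverses once more: t(hx, y) and eps(h) t(x, y) both invert s(hx, y) = eps(h) s(x,
    y), as functions of h, x and y. *)
Lemma convolution_inverse_inH_invariant (s t : tensor B B -> K) :
  @lin K _ K^o s -> @lin K _ K^o t ->
  convolution_inverse (@comulBB K B) (@counitBB K B) *%R (1 : K^o) s t ->
  (forall h x y, s (m (inH h) x \ox y) = hcounit h * s (x \ox y)) ->
  forall h x y, t (m (inH h) x \ox y) = hcounit h * t (x \ox y).
Proof.
move=> ls lt st sH h x y.
have cE := comulBBE hB.
have st1 u v : \tsum_(u1 \ox u2 <- D u) \tsum_(v1 \ox v2 <- D v)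
    s (u1 \ox v1) * t (u2 \ox v2) = eps u * eps v.
  rewrite -(counitBBE hB) -[RHS]mulr1 -[RHS]/(counitBB (u \ox v) *: (1 : K^o)).
  by rewrite -(st _).1 /convolution; sw.
have st2 u v : \tsum_(u1 \ox u2 <- D u) \tsum_(v1 \ox v2 <- D v)
    t (u1 \ox v1) * s (u2 \ox v2) = eps u * eps v.
  rewrite -(counitBBE hB) -[RHS]mulr1 -[RHS]/(counitBB (u \ox v) *: (1 : K^o)).
  by rewrite -(st _).2 /convolution; sw.
transitivity (\tsum_(h1 \ox h2 <- hcomul h) \tsum_(x1 \ox x' <- D x) \tsum_(y1 \ox y' <- D y)
  t (m (inH h1) x1 \ox y1) * (hcounit h2 * \tsum_(x2 \ox x3 <- D x') \tsum_(y2 \ox y3 <- D y')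
    s (x2 \ox y2) * t (x3 \ox y3))).
  under [RHS]eq_tlift do under eq_tlift do under eq_tlift do rewrite st1.
  by sw.
transitivity (\tsum_(h1 \ox h2 <- hcomul h) \tsum_(x1 \ox x' <- D x) \tsum_(y1 \ox y' <- D y)
  t (m (inH h1) x1 \ox y1) * \tsum_(x2 \ox x3 <- D x') \tsum_(y2 \ox y3 <- D y')
    s (m (inH h2) x2 \ox y2) * t (x3 \ox y3)).
  do 3! (apply: eq_tlift => ? ?); congr (_ * _).
  rewrite -[LHS]/( *%R (_ : K^o) _) (@tlift_lin _ K^o K^o) //; last exact: lin_mulKr.
  apply: eq_tlift => x2 x3; rewrite (@tlift_lin _ K^o K^o) //; last exact: lin_mulKr.
  by apply: eq_tlift => y2 y3; rewrite sH mulrA.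
transitivity (\tsum_(x' \ox x3 <- D x) \tsum_(y' \ox y3 <- D y)
  (\tsum_(u1 \ox u2 <- D (m (inH h) x')) \tsum_(v1 \ox v2 <- D y')
    t (u1 \ox v1) * s (u2 \ox v2)) * t (x3 \ox y3)); first by sw; rewrite ?mulrA.
under eq_tlift do under eq_tlift do rewrite st2.
by sw.
Qed.

(** Invariance at r # 1 and s # 1 is already H-linearity of q, because (1 # h)(r # 1) = h_(1).r #
    h_(2) and Phi lets h_(2) act on s. *)
Lemma Phi_inH_hlinear (q : tensor R R -> K) : @lin K _ K^o q ->
  (forall h x y, Phi q (m (inH h) x \ox y) = hcounit h * Phi q (x \ox y)) ->
  hlinear_form q.
Proof.
move=> lq qH; split=> // h r s.
have -> : hcounit h * q (r \ox s) = hcounit h * Phi q (inR r \ox inR s).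
  by rewrite PhiE // yd_act1 hcounit1 mulr1.
rewrite -qH boson_inH_inR; have lP := Phi_lin lq.
transitivity (\tsum_(h1 \ox h2 <- hcomul h) Phi q ((act h1 r \ox h2 : B) \ox inR s)).
  by apply: eq_tlift => h1 h2; rewrite PhiE // hcounit1 mulr1.
by sw.
Qed.

Section Cocycle.
Variable s : tensor B B -> K.
Hypothesis cs : two_cocycle s.
Hypothesis bs : hbilinear_section (twist_pair s).
Local Notation tw := (@twist_mul K B s).

Let s_lin : @lin K _ K^o s. Proof. by case: cs. Qed.
Hint Resolve s_lin : lin.
Let tw_linl y : lin (tw^~ y). Proof. exact: (twist_linl hB cs). Qed.
Let tw_linr x : lin (tw x). Proof. exact: (twist_linr hB cs). Qed.
Hint Resolve tw_linl tw_linr : lin.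

(** The section of [twist_pair] is [id], so this is H-bilinearity with a trivial right factor. *)
Lemma twist_inH_l h x : tw (inH h) x = m (inH h) x.
Proof.
move: x; apply: tensor_ext; [exact: tw_linr | exact: m_linr | move=> r k].
have b : m (m (inH h) (r \ox k)) (bi_one B) = tw (tw (inH h) (r \ox k)) (bi_one B) := bs r h k 1.
by rewrite m1r (twist1r hB cs) in b.
Qed.

Lemma twist_inH_r h x : tw x (inH h) = m x (inH h).
Proof.
move: x; apply: tensor_ext; [exact: tw_linl | exact: m_linl | move=> r k].
have b : m (m (bi_one B) (r \ox k)) (inH h) = tw (tw (bi_one B) (r \ox k)) (inH h) := bs r 1 k h.
by rewrite m1l (twist1l hB cs) in b.
Qed.

Lemma eps_twist x y : eps (tw x y) = s (x \ox y).
Proof. by rewrite /twist_mul; sw. Qed.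

(** With . the twisted product, of which s is the counit: s(hx, y) = s(h, x.y) = eps(h (x.y)) =
    eps(h) s(x, y). *)
Lemma cocycle_inH_l h x y : s (m (inH h) x \ox y) = hcounit h * s (x \ox y).
Proof.
rewrite -twist_inH_l (cocycle_twist cs) -eps_twist twist_inH_l epsM.
by rewrite boson_eps_inH eps_twist.
Qed.

Lemma cocycle_inH_m h x y : s (m x (inH h) \ox y) = s (x \ox m (inH h) y).
Proof. by rewrite -twist_inH_r (cocycle_twist cs) twist_inH_l. Qed.

Lemma cocycle_inH_r h x y : s (x \ox m y (inH h)) = hcounit h * s (x \ox y).
Proof.
rewrite -twist_inH_r -(cocycle_twist cs) -eps_twist twist_inH_r epsM.
by rewrite boson_eps_inH eps_twist mulrC.
Qed.

Definition base_form (t : tensor B B -> K) (z : tensor R R) : K :=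
  tlift (fun r s => t (inR r \ox inR s)) z.

Lemma base_form_lin t : @lin K _ K^o t -> @lin K _ K^o (base_form t).
Proof. by move=> lt; apply: (@lin_tlift _ _ _ K^o); lin. Qed.

Lemma base_formE t r u : @lin K _ K^o t -> base_form t (r \ox u) = t (inR r \ox inR u).
Proof. by move=> lt; rewrite /base_form (@tlift_pureE _ K^o) //; lin. Qed.

(** s(rh, uk) = s(r, huk) = eps(k) s(r, hu), and hu = (h_(1).u) h_(2), where h_(2) is removed by
    invariance on the right. *)
Lemma cocycle_Phi : s =1 Phi (base_form s).
Proof.
have lb := base_form_lin s_lin; have lP := Phi_lin lb.
apply: (@tensor_ext _ _ _ K^o); [lin | lin | move=> x y].
move: x; apply: (@tensor_ext _ _ _ K^o); [lin | lin | move=> r h].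
move: y; apply: (@tensor_ext _ _ _ K^o); [lin | lin | move=> u k].
rewrite PhiE // base_formE // -(boson_inR_inH r h) -(boson_inR_inH u k).
rewrite cocycle_inH_m mA cocycle_inH_r boson_inH_inR mulrC; congr (_ * _).
transitivity (\tsum_(h1 \ox h2 <- hcomul h) s (inR r \ox m (inR (act h1 u)) (inH h2))).
  by under [RHS]eq_tlift do rewrite boson_inR_inH; sw.
by under eq_tlift do rewrite cocycle_inH_r; sw.
Qed.

Theorem hbilinear_cocycle_Phi : exists2 p, Z_R p & s = Phi p.
Proof.
exists (base_form s); last by apply: funext; exact: cocycle_Phi.
have lb := base_form_lin s_lin.
have hp : hlinear_form (base_form s).
  by apply: Phi_inH_hlinear => // h x y; rewrite -!cocycle_Phi cocycle_inH_l.
case: (cs) => _ [t lt0 st] s11 cocy; have lt : @lin K _ K^o t := lt0.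
have lbt := base_form_lin lt.
(* In s * t at r # 1 and u # 1 the second legs lie in R, so t enters only through its restriction,
   while s is known to be Phi of its own. In t * s the first legs carry H-components, on which t is
   not yet under control. *)
have pq w : convolution (@comulRR K H R) *%R (base_form s : _ -> K^o) (base_form t) w
    = counitRR w *: (1 : K^o).
  have lc := @comulRR_lin K H R; have le := @counitRR_lin K H R.
  move: w; apply: (@tensor_ext _ _ _ K^o); [rewrite /convolution; lin | lin | move=> r u].
  have := (st (inR r \ox inR u)).1; rewrite (counitBBE hB) /= !boson_counitE hcounit1 !mulr1.
  rewrite counitRRE => <-.
  have cE x y : comulBB (x \ox y : tensor B B) =
    \tsum_(x1 \ox x2 <- boson_comul x) \tsum_(y1 \ox y2 <- boson_comul y)
      (x1 \ox y1 : tensor B B) \ox (x2 \ox y2 : tensor B B) by exact: comulBBE hB x y.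
  have rE := @comulRRE K H R.
  transitivity (\tsum_(r1 \ox r2 <- yd_comul r) \tsum_(u1 \ox u2 <- yd_comul u)
    \tsum_(c \ox r0 <- yd_coact r2) \tsum_(d \ox u0 <- yd_coact u2)
      s ((r1 \ox c : B) \ox (u1 \ox d : B)) * t (inR r0 \ox inR u0)); last first.
    by rewrite /convolution; sw; rewrite ?mulr1.
  under [RHS]eq_tlift do under eq_tlift do under eq_tlift do under eq_tlift do
    rewrite cocycle_Phi PhiE // -base_formE //.
  by rewrite /convolution; sw.
have PsE : Phi (base_form s) = s by apply: funext => z; rewrite -cocycle_Phi.
(* By [pq] and multiplicativity of Phi, the right-hand side is a right inverse of s; t is a left
   inverse. *)
have tE z : t z = Phi (base_form t) z.
  have KA : ualg (A := K^o) *%R 1.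
    split; [split => ?; lin | exact: mulrA | exact: mul1r | exact: mulr1].
  have lP := Phi_lin lbt.
  move: z; apply: (convolution_inverse_uniq (comulBB_coalgebra hB) KA (f := s)) => // z.
    exact: (st z).2.
  by rewrite -[in LHS]PsE; apply: Phi_convolution.
have tH h x y : t (m (inH h) x \ox y) = hcounit h * t (x \ox y).
  by apply: (convolution_inverse_inH_invariant s_lin lt st); exact: cocycle_inH_l.
split => //.
- exists (base_form t).
    by apply: Phi_inH_hlinear => // h x y; rewrite -!tE tH.
  move=> w; split; first exact: pq.
  have lc := @comulRR_lin K H R; have le := @counitRR_lin K H R.
  move: w; apply: (@tensor_ext _ _ _ K^o); [rewrite /convolution; lin | lin | move=> r u].
  (* As t is now known to be Phi of its restriction, the law for t * s at r # 1 and u # 1 is the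
     missing law over R (x) R. *)
  have := Phi_convolutionE r u 1 1 lbt lb.
  rewrite yd_act1 hcounit1 mulr1 => <-; rewrite PsE.
  have -> : Phi (base_form t) = t by apply: funext => z; rewrite -tE.
  have := (st (inR r \ox inR u)).2; rewrite (counitBBE hB) /= !boson_counitE hcounit1 !mulr1.
  by rewrite counitRRE.
- by rewrite base_formE.
- move=> r u v.
  have := cocy (inR r) (inR u) (inR v); rewrite -{1 2 3 4}PsE => c0.
  have := etrans (esym (Phi_left lb r u v 1 1 1)) (etrans c0 (Phi_right lb hp.2 r u v 1 1 1)).
  rewrite hcounit1 !mulr1.
  have E (F : R -> R -> R -> K) : (forall r, @blin K R R K^o (F r)) ->
      \tsum_(h1 \ox h2 <- hcomul (1 : H)) F r (act h1 u) (act (h2 * 1) v) = F r u v.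
    move=> bF; have bl x y : @lin K R K^o (F x y) by case: (bF x).
    have br x y : @lin K R K^o ((F x)^~ y) by case: (bF x).
    by etransitivity; [nf|].
  by rewrite (E (Zleft _)) ?(E (Zright _)) // => ?; rewrite /Zleft /Zright; lin.
Qed.

End Cocycle.
End HBilinear.

(** * The twisted algebra attached to an element of Z(R) *)

Section TwistedProduct.
Variables (K : fieldType) (H : hopfAlgebra K) (R : ydHopfAlgebra H).
Variable p : tensor R R -> K.
Hypothesis zp : Z_R p.
Local Notation act := (@yd_act K H R).
Local Notation B := (boson R).
Local Notation tw := (@twist_mul K B (Phi p)).

Let hB := boson_hopf R.
Let cs : two_cocycle (Phi p). Proof. exact: Phi_cocycle. Qed.
Let lp : @lin K _ K^o p. Proof. by case: zp => -[]. Qed.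
Let tw_linl y : lin (tw^~ y). Proof. exact: (twist_linl hB cs). Qed.
Let tw_linr x : lin (tw x). Proof. exact: (twist_linr hB cs). Qed.
Let MR_linl := smash_linl (yd_module_algebra R).
Let MR_linr := smash_linr (yd_module_algebra R).
Let lP := Phi_lin lp.
Hint Resolve lp lP tw_linl tw_linr MR_linl MR_linr : lin.

Definition twisted_mul (r s : R) : R :=
  \tsum_(r1 \ox r2 <- yd_comul r) \tsum_(s1 \ox s2 <- yd_comul s)
  \tsum_(c \ox r0 <- yd_coact r2) p (r1 \ox act c s1) *: (r0 * s2).
Local Notation tm := twisted_mul.

Lemma twisted_linl s : lin (tm^~ s). Proof. by rewrite /twisted_mul; lin. Qed.
Lemma twisted_linr r : lin (tm r). Proof. by rewrite /twisted_mul; lin. Qed.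
Hint Resolve twisted_linl twisted_linr : lin.

(** The twist is thus the smash product of (R, [tm]) with H, and the algebra laws of [tm] are pulled
    back from those of [tw] through [boson_proj], which splits the inclusion of R. *)
Lemma twist_PhiE (r s : R) (h k : H) : tw (r \ox h : B) (s \ox k : B) =
  \tsum_(h1 \ox h2 <- hcomul h) tm r (act h1 s) \ox (h2 * k).
Proof.
transitivity (\tsum_(r1 \ox r2 <- yd_comul r) \tsum_(s1 \ox s2 <- yd_comul s)
  \tsum_(c \ox r0 <- yd_coact r2) \tsum_(h1 \ox h2 <- hcomul h) \tsum_(d \ox s0 <- yd_coact s2)
  \tsum_(k1 \ox k2 <- hcomul k)
   Phi p ((r1 \ox (c * h1) : B) \ox (s1 \ox (d * k1) : B))
     *: smash_mul act (r0 \ox h2) (s0 \ox k2)).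
  rewrite -[LHS]/(\tsum_(x1 \ox x2 <- boson_comul (r \ox h))
    \tsum_(y1 \ox y2 <- boson_comul (s \ox k))
    Phi p (x1 \ox y1 : tensor B B) *: smash_mul act x2 y2).
  by sw.
under eq_tlift do under eq_tlift do under eq_tlift do under eq_tlift do under eq_tlift do
  under eq_tlift do rewrite PhiE // (smash_mulE (yd_module_algebra R)).
by rewrite /twisted_mul; sw.
Qed.

Definition boson_proj (x : B) : R := \tsum_(r \ox h <- x) hcounit h *: r.
Lemma boson_proj_lin : lin boson_proj. Proof. by rewrite /boson_proj; lin. Qed.
Hint Resolve boson_proj_lin : lin.
Lemma boson_projE (r : R) (h : H) : boson_proj (r \ox h) = hcounit h *: r.
Proof. by rewrite /boson_proj tlift_pureE //; lin. Qed.

Local Notation inR r := ((r : R) \ox (1 : H) : bi_space B).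
Local Notation inH h := ((1 : R) \ox (h : H) : bi_space B).

Lemma boson_proj_inR r : boson_proj (inR r) = r.
Proof. by rewrite boson_projE hcounit1 scale1r. Qed.

Lemma twist_inR (r s : R) (k : H) : tw (inR r) (s \ox k) = tm r s \ox k.
Proof. by rewrite twist_PhiE; etransitivity; [nf|]. Qed.

Lemma twisted_mulA : associative tm.
Proof.
move=> r s t; rewrite -[LHS]boson_proj_inR -[RHS]boson_proj_inR; congr boson_proj.
by rewrite -!twist_inR (twistA hB cs).
Qed.

Lemma twisted_mul1l : left_id 1 tm.
Proof.
move=> r; rewrite -[LHS]boson_proj_inR -[RHS]boson_proj_inR; congr boson_proj.
by rewrite -!twist_inR; apply: (twist1l hB cs).
Qed.

Lemma twisted_mul1r : right_id 1 tm.
Proof.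
move=> r; rewrite -[LHS]boson_proj_inR -[RHS]boson_proj_inR; congr boson_proj.
by rewrite -!twist_inR; apply: (twist1r hB cs).
Qed.

Lemma twist_inH (r : R) (h k : H) : tw (inH h) (r \ox k) =
  \tsum_(h1 \ox h2 <- hcomul h) act h1 r \ox (h2 * k).
Proof. by rewrite twist_PhiE; apply: eq_tlift => h1 h2; rewrite twisted_mul1l. Qed.

(** Associativity of the twisted product on 1 # h, r # 1, s # 1, projected to R. *)
Lemma act_twisted_mul h r s : act h (tm r s) =
  \tsum_(h1 \ox h2 <- hcomul h) tm (act h1 r) (act h2 s).
Proof.
transitivity (boson_proj (tw (inH h) (inR (tm r s)))).
  rewrite twist_inH; symmetry.
  transitivity (\tsum_(h1 \ox h2 <- hcomul h) hcounit h2 *: act h1 (tm r s)); last by sw.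
  rewrite (tlift_lin _ _ boson_proj_lin); apply: eq_tlift => h1 h2.
  by rewrite boson_projE mulr1.
rewrite -twist_inR (twistA hB cs) twist_inH (tlift_lin _ _ (tw_linl _)).
rewrite (tlift_lin _ _ boson_proj_lin).
transitivity (\tsum_(h1 \ox h2 <- hcomul h) \tsum_(a \ox b <- hcomul h2)
   hcounit b *: tm (act h1 r) (act a s)); last by sw.
apply: eq_tlift => h1 h2; rewrite twist_PhiE (tlift_lin _ _ boson_proj_lin) mulr1.
by apply: eq_tlift => a b; rewrite boson_projE mulr1.
Qed.

Lemma yd_comul_twisted r s : yd_comul (tm r s) =
  \tsum_(r1 \ox r2 <- yd_comul r) \tsum_(s1 \ox s2 <- yd_comul s)
  \tsum_(c \ox r0 <- yd_coact r2) tm r1 (act c s1) \ox (r0 * s2).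
Proof. by rewrite /twisted_mul; sw. Qed.

End TwistedProduct.

(** * The R-cleft object on the space R *)

Section TwistedAlgebra.
Variables (K : fieldType) (H : hopfAlgebra K) (R : ydHopfAlgebra H).
Variable p : tensor R R -> K.

(** An alias of R to carry a second product; [zp] is part of the type because the ring laws attached
    to it depend on this proof. *)
Definition twisted (zp : Z_R p) : Type := yd_alg R.
Variable zp : Z_R p.
Local Notation T := (twisted zp).

HB.instance Definition _ := GRing.Lmodule.copy T (yd_alg R).

Let mulDl : left_distributive (@twisted_mul K H R p) +%R.
Proof. by move=> x y z; apply: (linD _ _ (twisted_linl zp z)). Qed.
Let mulDr : right_distributive (@twisted_mul K H R p) +%R.
Proof. by move=> x y z; apply: (linD _ _ (twisted_linr zp x)). Qed.
Let neq0 : (1 : R) != 0. Proof. exact: oner_neq0. Qed.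

HB.instance Definition _ := GRing.Zmodule_isNzRing.Build T
  (twisted_mulA zp) (twisted_mul1l zp) (twisted_mul1r zp) mulDl mulDr neq0.


Let mulE (x y : T) : x * y = twisted_mul p x y. Proof. by []. Qed.
Let scaleE a (x : T) : a *: x = @GRing.scale K R a (x : R). Proof. by []. Qed.

(* [T] unfolds to [R], so the casts select the twisted product. *)
Let scalAl (a : K) (x y : T) : a *: (x * y : T) = (a *: x : T) * y.
Proof.
rewrite mulE [RHS]mulE !scaleE.
exact: esym (@linZ K R R (fun z => twisted_mul p z y) a x (twisted_linl zp y)).
Qed.
HB.instance Definition _ := GRing.Lmodule_isLalgebra.Build K T scalAl.
Let scalAr (a : K) (x y : T) : a *: (x * y : T) = x * (a *: y : T).
Proof.
rewrite mulE [RHS]mulE !scaleE.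
exact: esym (@linZ K R R (twisted_mul p x) a y (twisted_linr zp x)).
Qed.
HB.instance Definition _ := GRing.Lalgebra_isAlgebra.Build K T scalAr.

Local Notation act := (@yd_act K H R : H -> T -> T).
Local Notation rho := (@yd_comul K H R : T -> tensor T R).
Local Notation B := (boson R).
Local Notation tw := (@twist_mul K B (Phi p)).
Local Notation inR r := ((r : R) \ox (1 : H) : bi_space B).
Local Notation inH h := ((1 : R) \ox (h : H) : bi_space B).

Let hB := boson_hopf R.
Let cs : two_cocycle (Phi p). Proof. exact: Phi_cocycle. Qed.

Let actT : @hmodule_algebra K H T act.
Proof.
split; last exact: (act_twisted_mul zp).
- by case: (yd_module_algebra R).
- exact: yd_act_1.
Qed.

Let comT : @right_comodule K R T (@yd_comul K H R) (@yd_counit K H R) rho.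
Proof. by case: (yd_coalgebra R). Qed.

Lemma yd_coinvariantP (r : R) : yd_comul r = r \ox 1 <-> exists a : K, r = a *: 1.
Proof.
split=> [Dr|[a ->]].
  exists (yd_counit r); have E : \tsum_(r1 \ox r2 <- yd_comul r) yd_counit r1 *: r2 = r.
    by etransitivity; [nf|].
  by rewrite -{1}E Dr tlift_pureE //; lin.
by rewrite (linZ _ _ (@yd_comul_lin K H R)) yd_comul1 (linZ _ _ (@lin_tpurel _ _ _ _)).
Qed.

Lemma smash_twist (x y : B) : smash_mul act (x : tensor T H) (y : tensor T H) = tw x y.
Proof.
have tl z : lin (tw^~ z) := twist_linl hB cs z; have tr z : lin (tw z) := twist_linr hB cs z.
move: x; apply: tensor_ext; [exact: (smash_linl actT y) | exact: tl | move=> r h].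
move: y; apply: tensor_ext; [exact: (smash_linr actT (r \ox h)) | exact: tr | move=> s k].
by rewrite (twist_PhiE zp) -(smash_mulE actT).
Qed.

Section Inverse.
Variable g' : B -> B.
Hypothesis lg' : lin g'.
Hypothesis g'P : convolution_inverse (@bi_comul K B) (@bi_counit K B) tw (bi_one B) id g'.

(** The formula of [smash_inverse] solved for the inverse over R: r_(-1) g'(r_(0) # 1), projected to
    R. *)
Definition twisted_inverse (r : R) : T :=
  boson_proj (\tsum_(c \ox r0 <- yd_coact r) tw (inH c) (g' (inR r0))).

Let tw_linl z : lin (tw^~ z). Proof. exact: (twist_linl hB cs z). Qed.
Let tw_linr z : lin (tw z). Proof. exact: (twist_linr hB cs z). Qed.
Let tm_linl z : lin ((twisted_mul p)^~ z). Proof. exact: (twisted_linl zp z). Qed.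
Let tm_linr z : lin (twisted_mul p z). Proof. exact: (twisted_linr zp z). Qed.
Let proj_lin := @boson_proj_lin K H R.
Hint Resolve lg' tw_linl tw_linr tm_linl tm_linr proj_lin : lin.

Lemma twisted_inverse_lin : @lin K R R twisted_inverse.
Proof. by rewrite /twisted_inverse; lin. Qed.

Lemma proj_twist_inR a y : boson_proj (tw (inR a) y) = twisted_mul p a (boson_proj y).
Proof.
move: y; apply: tensor_ext; [lin | lin | move=> s k].
by rewrite (twist_inR zp) !boson_projE (linZ _ _ (tm_linr a)).
Qed.

Lemma twisted_inverse_r r : convolution (@yd_comul K H R) (@GRing.mul T) id twisted_inverse r
  = yd_counit r *: (1 : T).
Proof.
transitivity (\tsum_(r1 \ox r2 <- yd_comul r) twisted_mul p r1 (twisted_inverse r2)) => //.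
rewrite /twisted_inverse; under eq_tlift do rewrite -proj_twist_inR.
transitivity (boson_proj (\tsum_(r1 \ox r2 <- yd_comul r) \tsum_(c \ox r0 <- yd_coact r2)
   tw (tw (inR r1) (inH c)) (g' (inR r0)))).
  under [in RHS]eq_tlift do under eq_tlift do rewrite -(twistA hB cs).
  by sw.
under eq_tlift do under eq_tlift do rewrite (twist_inR zp) (twisted_mul1r zp).
(* The elements r1 # c and r0 # 1 are the two legs of the comultiplication of r # 1. *)
have -> : \tsum_(r1 \ox r2 <- yd_comul r) \tsum_(c \ox r0 <- yd_coact r2)
   tw (r1 \ox c) (g' (inR r0)) = convolution (@boson_comul K H R) tw id g' (inR r).
  by rewrite /convolution; sw; rewrite mulr1.
rewrite (g'P (inR r)).1 (linZ _ _ proj_lin) boson_proj_inR.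
by rewrite /= boson_counitE hcounit1 mulr1.
Qed.

Let T_id_lin : @lin K R T id. Proof. by []. Qed.

(** The right law makes [smash_inverse] of [twisted_inverse] a right inverse of [id] over R # H. It
    therefore equals g', which is two-sided, and [left_inverse_of_smash] descends. *)
Lemma twisted_inverse_l r : convolution (@yd_comul K H R) (@GRing.mul T) twisted_inverse id r
  = yd_counit r *: (1 : T).
Proof.
move: r; apply: (left_inverse_of_smash actT T_id_lin (twisted_inverse_lin : @lin K R T _)).
have idE (x : tensor R H) : smash_ext (id : R -> T) x = x by exact: tlift_tpure.
have invE : g' =1 smash_inverse act twisted_inverse.
  have alB : ualg tw (bi_one B).
    split; [by split; [exact: tw_linl | exact: tw_linr] | exact: (twistA hB cs) | |].
      exact: (twist1l hB cs).
    exact: (twist1r hB cs).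
  apply: (convolution_inverse_uniq (ha_coalg hB) alB (f := id)) => //.
  - exact: (smash_inverse_lin actT (twisted_inverse_lin : @lin K R T _)).
  - by move=> x; exact: (g'P x).2.
  - move=> x; rewrite -[RHS](smash_ext_inverse_r actT T_id_lin
      (twisted_inverse_lin : @lin K R T _) x twisted_inverse_r).
    by apply: eq_tlift => x1 x2; rewrite smash_twist idE.
move=> x; rewrite -[RHS](g'P x).2.
by apply: eq_tlift => x1 x2; rewrite smash_twist invE idE.
Qed.

End Inverse.

Lemma twisted_section : Rsection act rho (id : R -> T).
Proof.
split=> //; first by move=> r; rewrite tlift_tpure.
have [_ [_ _ [g' lg' g'P] _]] := twist_cleft hB cs.
exists (twisted_inverse g'); split.
- exact: (twisted_inverse_lin lg').
- apply: (hlinear_inverse actT (g := id : R -> T) _ (twisted_inverse_lin lg' : @lin K R T _)) => //.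
  + exact: (twisted_inverse_r lg' g'P).
  + exact: (twisted_inverse_l lg' g'P).
- by move=> r; split; [exact: (twisted_inverse_r lg' g'P) | exact: (twisted_inverse_l lg' g'P)].
Qed.

Lemma twisted_cleft : Rcleft act rho.
Proof.
split.
- by split; [exact: actT | exact: comT | exact: yd_comul_act].
- exact: yd_comul1.
- exact: (yd_comul_twisted zp).
- exact: yd_coinvariantP.
- by exists id; exact: twisted_section.
Qed.

Definition twisted_pair : RcleftPair R := MkRcleftPair twisted_cleft twisted_section.

Lemma twist_smash_iso : Biso (twist_pair (Phi p)) (smash_pair twisted_pair).
Proof.
exists (id : boson R -> tensor T H); split => //.
- by split=> //; exists id.
- by move=> x y; rewrite /= smash_twist.
- by move=> x; rewrite [RHS]tlift_tpure.
- by move=> x; rewrite /= /smash_section /= tlift_tpure.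
Qed.

End TwistedAlgebra.

(** * Comparison of the classes *)

Section Iso.
Variables (K : fieldType) (B : bialgebraData K).
Implicit Types X Y Z : comodAlgPair B.

Lemma Biso_refl X : Biso X X.
Proof.
exists id; split=> //; first by split=> //; exists id.
by move=> x; rewrite tlift_tpure.
Qed.

Lemma Biso_sym X Y : Biso X Y -> Biso Y X.
Proof.
case=> f [[lf [k fK kK]] f1 fM f_col f_sec].
have lk : lin k.
  by move=> a x y; apply: (can_inj fK); rewrite kK lf !kK.
exists k; split.
- by split=> //; exists f.
- by rewrite -f1 fK.
- by move=> x y; apply: (can_inj fK); rewrite fM !kK.
- move=> y; rewrite -{2}(kK y) f_col tlift_tlift; last lin.
  transitivity (\tsum_(x \ox b <- ca_coact (k y)) x \ox b); first by rewrite tlift_tpure.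
  by apply: eq_tlift => x b; rewrite tlift_pureE ?fK //; lin.
- by move=> b; rewrite -f_sec fK.
Qed.

Lemma Biso_trans X Y Z : Biso X Y -> Biso Y Z -> Biso X Z.
Proof.
case=> f [[lf bf] f1 fM f_col f_sec] [g [[lg bg] g1 gM g_col g_sec]].
have lg' : lin g := lg.
exists (g \o f); split.
- by split; [move=> a x y; rewrite /= lf lg | exact: bij_comp].
- by rewrite /= f1.
- by move=> x y; rewrite /= fM gM.
- move=> x; rewrite /= g_col f_col tlift_tlift; last lin.
  by apply: eq_tlift => x0 x1; rewrite tlift_pureE //; lin.
- by move=> b; rewrite /= f_sec g_sec.
Qed.

Lemma Bclass_eq X Y : Biso X Y -> Bclass X = Bclass Y.
Proof.
move=> XY; apply: funext => Z; apply: propext; split=> [XZ|].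
  exact: Biso_trans (Biso_sym XY) XZ.
exact: Biso_trans XY.
Qed.

End Iso.

Section Classes.
Variables (K : fieldType) (H : hopfAlgebra K) (R : ydHopfAlgebra H).

Lemma hbilinear_iso (X Y : comodAlgPair (boson R)) :
  Biso X Y -> hbilinear_section X -> hbilinear_section Y.
Proof. by case=> f [_ _ fM _ fs] hX r h h' h''; rewrite -!fs hX !fM. Qed.

Section SmashExtension.
Variables (E : algType K) (act : H -> E -> E) (g : R -> E).
Hypotheses (actE : hmodule_algebra act) (lg : lin g).
Hypothesis (g_act : forall h r, g (yd_act h r) = act h (g r)).
Let act_linr := hact_linr actE.
Let act_linl := hact_linl actE.
Let act1 := hact1 actE.
Let actA := hactA actE.
Let act_1 := hact_1 actE.
Let act_mul := hact_mul actE.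
Hint Resolve lg act_linr act_linl : lin.
Hint Rewrite act1 actA act_1 act_mul g_act : leafsum.

Lemma smash_ext_hbilinear r h h' h'' :
  smash_ext g (smash_mul (@yd_act K H R)
    (smash_mul (@yd_act K H R) (1 \ox h) (r \ox h')) (1 \ox h'')) =
  smash_mul act (smash_mul act (1 \ox h) (g r \ox h')) (1 \ox h'').
Proof. by rewrite /smash_ext /smash_mul; sw; rewrite ?mulrA. Qed.

End SmashExtension.

Lemma smash_hbilinear (E : RcleftPair R) : hbilinear_section (smash_pair E).
Proof.
move=> r h h' h''; case: E => E act rho g cl sec.
have [[actE _ _] _ _ _ _] := cl; have [[lg g_act] _ _ g1] := sec.
(* Writing the unit of E as [g 1] makes 1 # h and 1 # h'' values of the section. *)
rewrite [LHS](smash_ext_hbilinear actE lg g_act) -[1]g1 /=.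
by rewrite -!(smash_extE (lg : lin g)).
Qed.

Lemma C'_bosonP (c : comodAlgPair (boson R) -> Prop) : C'_boson c ->
  exists2 p : tensor R R -> K, Z_R p & c = Bclass (twist_pair (Phi p)).
Proof.
case=> -[X cX ->] [Y XY hY].
have [s cs Xs] := cleft_twist (boson_hopf R) cX.
have hs : hbilinear_section (twist_pair s).
  exact: hbilinear_iso Xs (hbilinear_iso (Biso_sym XY) hY).
have [p zp sp] := hbilinear_cocycle_Phi cs hs.
by exists p => //; rewrite -sp; exact: Bclass_eq.
Qed.

End Classes.

Theorem corollary4p7 (K : fieldType) (H : hopfAlgebra K) (R : ydHopfAlgebra H) :
  [/\ forall p : tensor R R -> K, Z_R p -> two_cocycle (Phi p),
      forall c : comodAlgPair (boson R) -> Prop,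
        C'_boson c <->
        exists2 E : RcleftPair R, C_R (Rclass E) & c = Bclass (smash_pair E)
    & forall c : comodAlgPair (boson R) -> Prop,
        C'_boson c <->
        exists2 p : tensor R R -> K, Z_R p & c = Bclass (twist_pair (Phi p))].
Proof.
have smashC' (E : RcleftPair R) : C'_boson (Bclass (smash_pair E)).
  split; first by exists (smash_pair E); first exact: smash_cleft.
  by exists (smash_pair E); [exact: Biso_refl | exact: smash_hbilinear].
split=> [p|c|c]; first exact: Phi_cocycle.
- split=> [/C'_bosonP [p zp ->]|[E _ ->] //].
  exists (twisted_pair zp); first by exists (twisted_pair zp).
  by apply: Bclass_eq; exact: twist_smash_iso.
- split=> [/C'_bosonP //|[p zp ->]].
  by rewrite (Bclass_eq (twist_smash_iso zp)).
Qed.
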